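(* Let $n\ge 3$ and $1\le d\le\left\lfloor\frac{n-1}{2}\right\rfloor$ be integers. Suppose that $G$ is an $n$-vertex nonhamiltonian graph with minimum degree $\delta(G)\ge d$ such that there exists an integer $k\ge 2$ for which $$N_k(G)>\max\left\{h_k(n,d+2),\ h_k\left(n,\left\lfloor\tfrac{n-1}{2}\right\rfloor\right)\right\}.$$ Let $\mathcal{H}_{n,d}:=\{H_{n,d},\,H_{n,d+1},\,K'_{n,d},\,K'_{n,d+1},\,H'_{n,d}\}$. Then: (i) if $d=2$, then $G$ is (isomorphic to) a subgraph of $G'_{n,2}$ or of a graph in $\mathcal{H}_{n,2}$; (ii) if $d=3$, then $G$ is (isomorphic to) a subgraph of $F_{n,3}$ or of a graph in $\mathcal{H}_{n,3}$; (iii) if $d=1$ or $4\le d\le\left\lfloor\frac{n-1}{2}\right\rfloor$, then $G$ is (isomorphic to) a subgraph of a graph in $\mathcal{H}_{n,d}$.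
   Context: All graphs are finite and simple. A graph is nonhamiltonian if it has no hamiltonian cycle (a cycle through all its vertices). $N(v)$ is the neighborhood of $v$. $N_k(G)$ denotes the number of unlabeled copies of $K_k$ in $G$ (i.e., the number of $k$-element vertex sets inducing a complete graph). Define $$h_k(n,x):=\binom{n-x}{k}+x\binom{x}{k-1},$$ where for $a\in\mathbb{R}$ and $b\in\mathbb{N}$, $\binom{a}{b}=\frac{1}{b!}a(a-1)\cdots(a-b+1)$ if $a\ge b-1$ and $\binom{a}{b}=0$ otherwise (this formula is used for $h_k(n,d+2)$ also if $d+2>\lfloor (n-1)/2\rfloor$). The following $n$-vertex graphs are used (each being considered only for those parameters for which the construction makes sense). $H_{n,d}$: obtained from a complete graph $K_{n-d}$ with vertex set $A$ by adding $d$ pairwise nonadjacent new vertices of degree $d$, each adjacent to the same $d$ vertices in $A$. $K'_{n,d}$: the edge-disjoint union of complete graphs $K_{n-d}$ and $K_{d+1}$ sharing a single vertex. $H'_{n,d}$: $V(H'_{n,d})=A\cup B$ (disjoint), where $A$ induces a complete graph on $n-d-1$ vertices, $B$ is a set of $d+1$ vertices that induce exactly one edge, and there exists a set of $d$ vertices $\{a_1,\dots,a_d\}\subseteq A$ such that for all $b\in B$, $N(b)-B=\{a_1,\dots,a_d\}$. $G'_{n,2}$: $V(G'_{n,2})=A\cup B$ (disjoint), where $A$ induces a clique of order $n-3$, $B=\{b_1,b_2,b_3\}$ is an independent set of order $3$, and there exist four distinct vertices $a_1,a_2,a_3,x\in A$ such that $N(b_i)=\{a_i,x\}$ for $i\in\{1,2,3\}$.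 $F_{n,3}$: $V(F_{n,3})=A\cup B$ (disjoint), where $A$ induces a clique of order $n-4$, $B$ induces a perfect matching on $4$ vertices (i.e., two disjoint edges), and each of the vertices in $B$ is adjacent to the same two vertices in $A$ (and to no other vertices of $A$). *)

(* Defs.v *)
From HB Require Import structures.
From mathcomp Require Import all_boot all_order all_algebra.

Set Implicit Arguments.
Unset Strict Implicit.
Unset Printing Implicit Defensive.

Import Order.TTheory GRing.Theory Num.Theory.

Record sgraph := SGraph {
  vertex :> finType;
  adj : rel vertex;
  adj_sym : symmetric adj;
  adj_irr : irreflexive adj }.

Section Graph.
Variable G : sgraph.
Implicit Types (v : G) (A B S : {set G}).

Definition nbh v : {set G} := [set w | adj v w].

(* The seed #|G| exceeds every degree, so it is irrelevant if G has a vertex. *)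
Definition min_degree : nat := \big[minn/#|G|]_(v : G) #|nbh v|.

Definition clique S : bool :=
  [forall x in S, forall y in S, (x != y) ==> adj x y].

Definition independent S : bool :=
  [forall x in S, forall y in S, ~~ adj x y].

Definition cliques (k : nat) : {set {set G}} :=
  [set S : {set G} | (#|S| == k) && clique S].

Definition edges_in B : {set {set G}} := [set E in cliques 2 | E \subset B].

(* [cycle] accepts the empty sequence and, for adjacent x and y, [:: x; y];
   the size bound excludes them. *)
Definition hamiltonian : Prop :=
  exists s : seq G,
    [/\ 2 < size s, uniq s, cycle (@adj G) s & forall v, v \in s].

End Graph.

(* G is isomorphic to a (not necessarily induced) subgraph of H. *)
Definition subgraph_of (G H : sgraph) : Prop :=
  exists2 f : G -> H, injective f & forall x y, adj x y -> adj (f x) (f y).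

(* Each special graph is given by the predicate "H is (isomorphic to) that
   graph".  The predicate has no model when the parameters do not allow the
   construction.  ~: A is the vertex set added to the clique A. *)

(* H_{n,d} *)
Definition is_H (n d : nat) (H : sgraph) : Prop :=
  exists A S : {set H},
    [/\ #|H| = n, #|~: A| = d, clique A, independent (~: A) &
        [/\ S \subset A, #|S| = d & forall b, b \notin A -> nbh b = S]].

(* K'_{n,d}; the parts meet in one vertex, so #|A| = n - d. *)
Definition is_K' (n d : nat) (H : sgraph) : Prop :=
  exists (A B : {set H}) (v : H),
    [/\ #|H| = n, #|B| = d.+1, A :|: B = [set: H], A :&: B = [set v] &
        forall x y : H, adj x y =
          (x != y) && ((x \in A) && (y \in A) || (x \in B) && (y \in B))].

(* H'_{n,d} *)
Definition is_H' (n d : nat) (H : sgraph) : Prop :=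
  exists A S : {set H},
    [/\ #|H| = n, #|~: A| = d.+1, clique A, #|edges_in (~: A)| = 1 &
        [/\ S \subset A, #|S| = d &
            forall b, b \in ~: A -> nbh b :\: ~: A = S]].

(* G'_{n,2} *)
Definition is_G'2 (n : nat) (H : sgraph) : Prop :=
  exists (A : {set H}) (a1 a2 a3 x b1 b2 b3 : H),
    [/\ #|H| = n, clique A, independent (~: A),
        uniq [:: b1; b2; b3] & ~: A = [set b1; b2; b3]] /\
    [/\ uniq [:: a1; a2; a3; x], [set a1; a2; a3; x] \subset A,
        nbh b1 = [set a1; x], nbh b2 = [set a2; x] & nbh b3 = [set a3; x]].

(* F_{n,3} *)
Definition is_F3 (n : nat) (H : sgraph) : Prop :=
  exists (A S : {set H}) (b1 b2 b3 b4 : H),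
    [/\ #|H| = n, clique A, uniq [:: b1; b2; b3; b4],
        ~: A = [set b1; b2; b3; b4] &
        edges_in (~: A) = [set [set b1; b2]; [set b3; b4]]] /\
    [/\ S \subset A, #|S| = 2 & forall b, b \in ~: A -> nbh b :&: A = S].

Definition in_Hfamily (n d : nat) (H : sgraph) : Prop :=
  [\/ is_H n d H, is_H n d.+1 H, is_K' n d H | is_K' n d.+1 H] \/ is_H' n d H.

Local Open Scope ring_scope.

Definition gbinom (R : realFieldType) (a : R) (b : nat) : R :=
  if b%:R - 1 <= a then (b`!%:R)^-1 * \prod_(i < b) (a - i%:R) else 0.

(* Only meaningful for k >= 1. *)
Definition h_ (R : realFieldType) (k n : nat) (x : R) : R :=
  gbinom (n%:R - x) k + x * gbinom x k.-1.

(* Main.v *)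
Require Import Defs.
From HB Require Import structures.
From mathcomp Require Import all_boot all_order all_algebra.
From mathcomp Require Import zify.

Set Implicit Arguments.
Unset Strict Implicit.
Unset Printing Implicit Defensive.

Import Order.TTheory GRing.Theory Num.Theory.

(** Adding edges as long as no hamiltonian cycle appears keeps all hypotheses, so
the graph may be taken edge-maximal: any two nonadjacent vertices $x,y$ are then
joined by a hamiltonian path, and Ore's crossing argument on that path gives
$d(x)+d(y)\le n-1$ ([saturated_degree_sum]).

The clique count forces the shape of such a graph ([saturated_structure]). By
Posa's argument some $r\le\lfloor (n-1)/2\rfloor$ admits $r$ vertices of degree
at most $r$, which bounds the number of $k$-cliques by $h_k(n,r)$. For the
largest such $r$, the hypothesis $N_k(G)>h_k(n,\lfloor (n-1)/2\rfloor)$ shows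
that the set $D$ of vertices of degree at most $r$ has exactly $r$ elements and
that its complement is a clique. As $h_k(n,\cdot)$ is convex, the other half of
the hypothesis leaves $r\in\{d,d+1\}$.

Let $S$ be the set of vertices outside $D$ that are adjacent to all of $D$, and
$q=d-|S|$. Ore's bound shows that a vertex outside $D\cup S$ has at most one
neighbour in $D$, and none at all if $r=d$. So up to these extra neighbours the
graph is described by $S$ and the graph induced on $D$, whose degrees are about
$q$. Since the complement of $D$ is a clique, the graph is hamiltonian as soon
as $D$ is covered by few enough disjoint paths which vertices of $S$ can link
([weave]); an extra neighbour replaces a vertex of $S$ at the end of a path. The
least number of paths is $|D|$ minus the largest number of edges of a linear
forest in $D$, and a longest path, together with the rotations that are possible
when all neighbours of its end lie on it, provides a large enough linear forest
([regular_hamiltonian], [nearly_regular_hamiltonian], [rooted_hamiltonian],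
[two_entries_hamiltonian], [isolated_entries_hamiltonian]).

What escapes these lemmas is $q\le 0$, which gives $H_{n,d}$, $H_{n,d+1}$ or
$H'_{n,d}$; cases with $|S|\le 1$, which give $K'_{n,d}$ or $K'_{n,d+1}$; and,
for $q=1$, a perfect matching on the four vertices of $D$, which is $F_{n,3}$,
or at most three isolated vertices with one extra neighbour each: three of them
are $G'_{n,2}$ and two of them are contained in $H_{n,1}$. *)

(** * Edge-maximal nonhamiltonian graphs *)

Definition nverts (G : sgraph) : nat := #|vertex G|.

Definition hamiltonian_path (G : sgraph) (x : G) (s : seq G) :=
  [/\ uniq (x :: s), path (@adj G) x s & forall v, v \in x :: s].

Definition saturated (G : sgraph) :=
  ~ hamiltonian G /\
  forall x y : G, x != y -> ~~ adj x y ->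
    exists2 s, hamiltonian_path x s & last x s = y.

Lemma uniq_mem_size (T : finType) (s : seq T) :
  uniq s -> size s = #|T| -> forall v, v \in s.
Proof.
move=> us sz v; have := subset_leqif_card (subset_predT (mem s)).
by move=> [_]; rewrite (card_uniqP us) sz eqxx => /esym/subsetP->.
Qed.

Lemma uniq_size_mem (T : finType) (s : seq T) :
  uniq s -> (forall v, v \in s) -> size s = #|T|.
Proof.
by move=> us alls; rewrite -(card_uniqP us); apply/eq_card => v; rewrite alls.
Qed.

Lemma cliqueP (G : sgraph) (C : {set G}) :
  reflect {in C &, forall x y, x != y -> adj x y} (clique C).
Proof.
apply: (iffP forall_inP) => [h x y xC yC nxy|h x xC].
  by have /forall_inP/(_ y yC)/implyP/(_ nxy) := h x xC.
by apply/forall_inP=> y yC; apply/implyP; apply: h.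
Qed.

Lemma clique_path (G : sgraph) (C : {set G}) z r :
  clique C -> uniq (z :: r) -> {subset z :: r <= C} -> path (@adj G) z r.
Proof.
move=> /cliqueP cC; elim: r z => //= w r IH z /and3P[zn wn ur] sub.
rewrite cC ?sub ?inE ?eqxx ?orbT //=; last first.
  by apply: contraNneq zn => ->; rewrite mem_head.
by apply: IH => [|v vin]; rewrite /= ?wn // sub // inE vin orbT.
Qed.

(** If all vertices outside a clique lie on a path with both ends in the clique,
the remaining vertices of the clique close this path into a hamiltonian
cycle. *)
Lemma clique_path_hamiltonian (G : sgraph) (C : {set G}) x p :
  2 < nverts G -> clique C -> x \in C -> last x p \in C ->
  uniq (x :: p) -> path (@adj G) x p -> (forall v, v \notin C -> v \in x :: p) ->
  hamiltonian G.
Proof.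
move=> n2 cC xC lC us ps cov.
pose r := [seq v <- enum G | v \notin x :: p].
have rC : {subset r <= C}.
  by move=> v; rewrite mem_filter => /andP[+ _]; apply: contraR => /cov.
have ur : uniq (x :: p ++ r).
  rewrite -cat_cons cat_uniq us filter_uniq ?enum_uniq // andbT.
  by apply/hasPn=> v; rewrite mem_filter => /andP[].
have allr v : v \in x :: p ++ r.
  by rewrite -cat_cons mem_cat mem_filter mem_enum andbT orbN.
have sz : 2 < size (x :: p ++ r) by rewrite (uniq_size_mem ur allr).
exists (x :: p ++ r); split=> //.
have ulr : uniq (last x p :: r).
  have : uniq (rcons (belast x p) (last x p) ++ r) by rewrite -lastI.
  by rewrite cat_rcons cat_uniq => /and3P[].
have slr : {subset last x p :: r <= C}.
  by move=> v /predU1P[->|/rC].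
rewrite /cycle rcons_path cat_path ps (clique_path cC ulr slr) /=.
move/cliqueP: cC; apply=> //; first by rewrite last_cat; apply: slr (mem_last _ _).
case: (lastP (p ++ r)) sz ur => // u z _ /andP[xn _].
by rewrite last_rcons; apply: contraNneq xn => <-; rewrite mem_rcons mem_head.
Qed.

Lemma cycle_rev_cons (T : eqType) (e : rel T) (x : T) (s : seq T) :
  symmetric e -> cycle e (x :: rev s) = cycle e (x :: s).
Proof.
move=> sy; rewrite -(rot_cycle 1) rot1_cons -rev_cons rev_cycle.
by apply: eq_cycle => a b; rewrite sy.
Qed.

(** A hamiltonian cycle of the graph enlarged by the edge $xy$ must use that
edge; removing it leaves a hamiltonian path from $x$ to $y$. *)
Lemma hamiltonian_add_edge (T : finType) (e e' : rel T) (sy : symmetric e)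
    (ir : irreflexive e) (sy' : symmetric e') (ir' : irreflexive e') x y :
  (forall a b, e' a b = [|| e a b, (a == x) && (b == y) | (a == y) && (b == x)]) ->
  ~ hamiltonian (SGraph sy ir) -> hamiltonian (SGraph sy' ir') -> x != y ->
  exists2 s, @hamiltonian_path (SGraph sy ir) x s & last x s = y.
Proof.
move=> e'E nh [s0 [n2 us0 cs0 all0]] nxy.
have [i s defs] := rot_to (all0 x).
have us : uniq (x :: s) by rewrite -defs rot_uniq.
have cs : cycle e' (x :: s) by rewrite -defs rot_cycle.
have alls : forall v, v \in x :: s by move=> v; rewrite -defs mem_rot all0.
have ns : 1 < size s by move: n2; rewrite -(size_rot i) defs.
have ee' a b : e a b -> e' a b by rewrite e'E => ->.
have tail z s' : x \notin z :: s' -> path e' z s' -> path e z s'.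
  move=> xs; apply: (@sub_in_path _ (predC1 x)).
    move=> a b; rewrite !inE => ax bx; rewrite e'E.
    by rewrite (negPf ax) (negPf bx) andbF !orbF.
  by apply/allP => a ain; apply: contraNneq xs => <-.
have main s1 : last x s1 = y -> uniq (x :: s1) -> cycle e' (x :: s1) ->
    (forall v, v \in x :: s1) -> 1 < size s1 ->
    @hamiltonian_path (SGraph sy ir) x s1.
  move=> ly u1 c1 a1 n1; split=> //=.
  case: s1 ly u1 c1 a1 n1 => [|z [|w s1]] // ly /andP[xs u1] c1 a1 _.
  have zy : z != y.
    apply: contraTneq u1 => ->; rewrite -ly [last _ _]/=.
    by rewrite /= mem_last.
  have /andP[xz p1] : e' x z && path e' z (w :: s1).
    by move: c1; rewrite /cycle rcons_path => /andP[].
  rewrite -/(path e x (z :: w :: s1)) /= -/(path e z (w :: s1)) tail // andbT.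
  by move: xz; rewrite e'E eqxx (negPf zy) (negPf nxy) !orbF.
have [/eqP ly|nly] := boolP (last x s == y).
  by exists s => //; apply: main.
case: s us cs alls ns nly {defs} => // z s us cs alls ns nly.
have [zy|nzy] := eqVneq z y.
  have ly : last x (rev (z :: s)) = y by rewrite rev_cons last_rcons.
  exists (rev (z :: s)) => //; apply: main ly _ _ _ _ => //.
  - by rewrite cons_uniq mem_rev rev_uniq.
  - by rewrite cycle_rev_cons.
  - by move=> v; rewrite inE mem_rev -in_cons.
  - by rewrite size_rev.
case: nh; exists (x :: z :: s); split=> //.
move: us cs => /andP[xs us]; rewrite /= !rcons_path => /and3P[xz p1 lx].
rewrite tail // andTb; move: xz lx; rewrite !e'E !eqxx (negPf nxy) (negPf nzy).
rewrite !orbF !andbF !andbT /= => ->.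
by move: nly => /= /negPf->; rewrite orbF.
Qed.

Definition nonedges (T : finType) (e : rel T) : {set T * T} :=
  [set p | (p.1 != p.2) && ~~ e p.1 p.2].

(** A missing edge can be added without creating a hamiltonian cycle as long as
no hamiltonian path joins its ends, so this process stops at a saturated
graph. *)
Lemma saturated_supergraph (T : finType) (e : rel T) (sy : symmetric e)
    (ir : irreflexive e) :
  ~ hamiltonian (SGraph sy ir) ->
  exists (e' : rel T) (sy' : symmetric e') (ir' : irreflexive e'),
    (forall x y, e x y -> e' x y) /\ saturated (SGraph sy' ir').
Proof.
have [m] := ubnP #|nonedges e|; elim: m => // m IH in e sy ir * => le_m nh.
(* No hamiltonian path joins $x$ and $y$; tuples make this decidable. *)
pose bad x y := [forall s : #|T|.-tuple T,
  ~~ [&& uniq s, path e x (behead s), ohead s == Some x & last x (behead s) == y]].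
case: (boolP [exists x, exists y, [&& x != y, ~~ e x y & bad x y]]); last first.
  move=> nbad; exists e, sy, ir; split=> //; split=> // x y nxy nexy.
  move: nbad; rewrite negb_exists => /forallP/(_ x).
  rewrite negb_exists => /forallP/(_ y); rewrite nxy nexy /= negb_forall.
  case/existsP => s; rewrite negbK => /and4P[us ps /eqP os /eqP ls].
  case def_s : (tval s) os us ps ls => [//|z s'] /= [zx] us ps ls; subst z.
  exists s' => //; split=> //.
  by apply: uniq_mem_size => //; rewrite -def_s size_tuple.
case/existsP=> x /existsP[y /and3P[nxy nexy badxy]].
pose e' a b := [|| e a b, (a == x) && (b == y) | (a == y) && (b == x)].
have sy' : symmetric e'.
  by move=> a b; rewrite /e' sy; congr (_ || _); rewrite orbC; congr (_ || _); apply: andbC.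
have ir' : irreflexive e'.
  move=> a; rewrite /e' ir /=; apply/negbTE/negP.
  by case/orP=> /andP[/eqP-> /eqP eq]; rewrite eq eqxx in nxy.
case: (IH e' sy' ir').
- rewrite -ltnS; apply: leq_trans le_m; rewrite ltnS; apply/proper_card/properP.
  split.
    apply/subsetP=> p; rewrite !inE /e' => /andP[-> /=].
    by rewrite !negb_or => /and3P[].
  by exists (x, y); rewrite !inE /e' /= ?nxy ?nexy //= !eqxx orbT.
- move=> h; have [s [us ps alls] ls] := hamiltonian_add_edge (fun a b => erefl) nh h nxy.
  have sz : size (x :: s) = #|T| by apply: uniq_size_mem.
  move/forallP: badxy => /(_ (Tuple (introT eqP sz))) /negP[].
  by apply/and4P; split=> //=; rewrite ls.
move=> e2 [sy2 [ir2 [sub sat]]]; exists e2, sy2, ir2; split=> // a b eab.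
by apply: sub; rewrite /e' eab.
Qed.

Lemma cardsCG (G : sgraph) (B : {set G}) : #|B| + #|~: B| = nverts G.
Proof. exact: cardsC. Qed.

Section Saturated.
Variable G : sgraph.
Hypothesis satG : saturated G.
Implicit Types x y v : G.

(** Two crossing edges joining the ends of a hamiltonian path to consecutive
inner vertices close it into a hamiltonian cycle. *)
Lemma hamiltonian_path_no_crossing x s p a b q : 2 < nverts G ->
  hamiltonian_path x s -> x :: s = rcons p a ++ b :: q ->
  adj x b -> ~~ adj a (last x s).
Proof.
move=> n2 [us ps alls] def xb; apply/negP=> ay; case: (satG) => nh _; apply: nh.
exists (rcons p a ++ rev (b :: q)); split.
- by rewrite size_cat size_rev -size_cat -def (uniq_size_mem us alls).
- rewrite cat_uniq rev_uniq (eq_has_r (mem_rev _)) -cat_uniq -def //.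
- have lq : last x s = last b q.
    by rewrite -[LHS](last_cons x x) def last_cat.
  have: sorted (@adj G) (rcons p a ++ b :: q) by rewrite -def.
  have hd : head x (rcons p a) = x.
    by case: (p) def => [|c p'] /= [->].
  case def_p: (rcons p a) hd ay => [|c p'] /= hd ay; first by case: (p) def_p.
  subst c; rewrite cat_path => /andP[pp' /= /andP[_ pq]].
  have la : last x p' = a by rewrite -(last_cons x) -def_p last_rcons.
  rewrite rcons_path cat_path pp' la last_cat la /=.
  case: (lastP q) lq pq => [|q' z] lq pq.
    by rewrite /= andbT -[b]/(last b [::]) -lq ay lq /= adj_sym.
  rewrite last_rcons in lq; rewrite rev_cons rev_rcons rcons_cons /= -lq ay /=.
  rewrite last_rcons adj_sym xb andbT -rev_cons.
  have := rev_path (@adj G) b (rcons q' z); rewrite last_rcons belast_rcons lq.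
  move=> ->; rewrite (@eq_path _ _ (@adj G)) // => u w; exact: adj_sym.
- move=> v; have := alls v; rewrite def !mem_cat mem_rev //.
Qed.

Lemma path_pred x s b : uniq (x :: s) -> b \in x :: s -> b != x ->
  let a := nth x (x :: s) (index b (x :: s)).-1 in
  exists p q, x :: s = rcons p a ++ b :: q.
Proof.
move=> us bs nbx a; have ib : 0 < index b (x :: s) by rewrite /= eq_sym (negPf nbx).
have ls : index b (x :: s) < size (x :: s) by rewrite index_mem.
have ls' : (index b (x :: s)).-1 < size (x :: s) by apply: leq_ltn_trans ls; apply: leq_pred.
exists (take (index b (x :: s)).-1 (x :: s)), (drop (index b (x :: s)).+1 (x :: s)).
have -> : b :: drop (index b (x :: s)).+1 (x :: s) = drop (index b (x :: s)) (x :: s).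
  by rewrite [RHS](drop_nth x) // nth_index.
by rewrite -take_nth // prednK // cat_take_drop.
Qed.

(** Ore's bound: on a hamiltonian path from $x$ to $y$, the predecessors of the
neighbours of $x$ are different from $y$ and not adjacent to $y$. *)
Lemma saturated_degree_sum x y : 2 < nverts G -> x != y -> ~~ adj x y ->
  #|nbh x| + #|nbh y| < nverts G.
Proof.
move=> n2 nxy nexy; case: (satG) => _ /(_ x y nxy nexy) [s hp ls].
have [us ps alls] := hp.
pose f b := nth x (x :: s) (index b (x :: s)).-1.
have nbx b : b \in nbh x -> b != x.
  by rewrite inE; apply: contraTneq => ->; rewrite adj_irr.
have fP b : b \in nbh x -> exists p q, x :: s = rcons p (f b) ++ b :: q.
  by move=> /nbx; apply: path_pred.
have inj_f : {in nbh x &, injective f}.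
  move=> b b' /nbx hb /nbx hb' /eqP; rewrite nth_uniq //.
  - have i0 c : c != x -> 0 < index c (x :: s) by rewrite /= eq_sym => /negPf->.
    rewrite -eqSS !prednK ?i0 // => /eqP eqi.
    by rewrite -(nth_index x (alls b)) eqi nth_index.
  - by apply: leq_ltn_trans (leq_pred _) _; rewrite index_mem.
  - by apply: leq_ltn_trans (leq_pred _) _; rewrite index_mem.
rewrite -(card_in_imset inj_f).
have sub : y |: (f @: nbh x) \subset ~: nbh y.
  apply/subsetP=> a; rewrite !inE => /predU1P[->|/imsetP[b bx ->]].
    by rewrite adj_irr.
  have [p [q def]] := fP b bx.
  rewrite adj_sym -ls; apply: hamiltonian_path_no_crossing def _ => //.
  by move: bx; rewrite inE.
suff yn : y \notin f @: nbh x.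
  have := subset_leq_card sub; have := cardsCG (nbh y); rewrite cardsU1 yn; lia.
apply/imsetP=> -[b bx defy]; have [p [q def]] := fP b bx.
have := us; rewrite def cat_uniq => /and3P[_ /hasPn/(_ y) + _].
rewrite mem_rcons defy inE eqxx /= => h.
have: y \in b :: q by rewrite -ls -(last_cons x x) def last_cat /= mem_last.
by move=> hy; have := h; rewrite -defy hy => /(_ isT).
Qed.

(** Posa's degree condition, for edge-maximal graphs: take a nonadjacent pair
$x,y$ of maximum degree sum, with $x$ of smaller degree; every non-neighbour
of $y$ has degree at most that of $x$, and there are at least $d(x)$ of them
by Ore's bound. *)
Lemma saturated_low_degree (d : nat) : 2 < nverts G -> 0 < d ->
    (forall v : G, d <= #|nbh v|) ->
  exists2 r, 0 < r <= (nverts G).-1./2 & r <= #|[set v : G | #|nbh v| <= r]|.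
Proof.
move=> n2 d0 dmin.
pose P (p : G * G) := (p.1 != p.2) && ~~ adj p.1 p.2.
have [p0 Pp0] : exists p, P p.
  apply/existsP; case: (boolP [exists p, P p]) => // /existsPn noP.
  have full x y : x != y -> adj x y.
    by move=> nxy; have := noP (x, y); rewrite /P /= nxy negbK.
  case: (satG) => nh _; case: nh.
  have /card_gt0P[x _] : 0 < nverts G by lia.
  apply: (@clique_path_hamiltonian _ [set: G] x [::]) => //.
  - by apply/cliqueP => a b _ _; apply: full.
  - by move=> v; rewrite inE.
pose sumd (p : G * G) := #|nbh p.1| + #|nbh p.2|.
have [[x y] /andP[/= nxy nexy] maxP] := arg_maxnP sumd Pp0.
wlog le_xy : x y nxy nexy maxP / #|nbh x| <= #|nbh y|.
  move=> IH; case: (leqP #|nbh x| #|nbh y|) => [|/ltnW] h; first exact: (IH x y).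
  apply: (IH y x) => //; [by rewrite eq_sym|by rewrite adj_sym|].
  by move=> p /maxP; rewrite /sumd /= [#|nbh y| + _]addnC.
have sum := saturated_degree_sum n2 nxy nexy.
exists #|nbh x|.
  rewrite (leq_trans d0 (dmin x)) geq_half_double /=.
  lia.
have sub : ~: (y |: nbh y) \subset [set v | #|nbh v| <= #|nbh x|].
  apply/subsetP=> v; rewrite !inE negb_or => /andP[nvy neyv].
  have /maxP : P (v, y) by rewrite /P /= nvy adj_sym.
  by rewrite /sumd /= leq_add2r.
apply: leq_trans (subset_leq_card sub).
have := cardsCG (y |: nbh y); rewrite cardsU1 inE adj_irr /=; lia.
Qed.

End Saturated.

(** * Counting cliques *)

(** The integer form of $h_k(n,j)$. *)
Definition hnat (k n j : nat) : nat := 'C(n - j, k) + j * 'C(j, k.-1).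

Lemma gbinom_nat (R : realFieldType) (a b : nat) :
  gbinom (a%:R : R)%R b = ('C(a, b)%:R)%R.
Proof.
rewrite /gbinom lerBlDr natr1 ler_nat.
case: leqP => [le_ba|lt_ab]; last by rewrite bin_small // ltnW.
have fact0 : (b`!%:R : R)%R != 0%R by rewrite pnatr_eq0 -lt0n fact_gt0.
apply: (mulfI fact0); rewrite mulVKf // mulrC -natrM bin_ffact ffact_prod natr_prod.
apply: eq_bigr => i _; rewrite natrB //; have := ltn_ord i; lia.
Qed.

Lemma h_nat (R : realFieldType) (k n j : nat) :
  j <= n -> h_ k n (j%:R : R)%R = ((hnat k n j)%:R)%R.
Proof. by move=> le_jn; rewrite /h_ -natrB // !gbinom_nat -natrM -natrD. Qed.

(** $h_k(n,\cdot)$ is discretely convex: its increment at $j$ is the difference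
of the nondecreasing $\binom{j+1}{k-1}+j\binom{j}{k-2}$ and the nonincreasing
$\binom{n-j-1}{k-1}$. *)
Lemma hnat_convex k n l r u : 2 <= k -> l <= r <= u -> u <= n ->
  hnat k n r <= maxn (hnat k n l) (hnat k n u).
Proof.
case: k => [|[|k]] // _ /andP[le_lr le_ru] le_un.
pose up j := 'C(j.+1, k.+1) + j * 'C(j, k).
pose down j := 'C(n - j.+1, k.+1).
have step j : j < n -> hnat k.+2 n j.+1 + down j = hnat k.+2 n j + up j.
  move=> lt_jn; rewrite /hnat /up /down /= -(subnSK lt_jn) !binS; lia.
have up_mono j j' : j <= j' -> up j <= up j'.
  by move=> le_jj; rewrite leq_add ?leq_mul ?leq_bin2l.
have down_mono j j' : j <= j' -> down j' <= down j.
  by move=> le_jj; rewrite leq_bin2l // leq_sub2l.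
rewrite leq_max; have [le_du|lt_ud] := leqP (down r) (up r).
  apply/orP; right.
  have: forall i, r + i <= n -> hnat k.+2 n r <= hnat k.+2 n (r + i).
    elim=> [|i IH] le_n; first by rewrite addn0.
    rewrite addnS in le_n *; apply: leq_trans (IH (ltnW le_n)) _.
    have := step _ le_n; have := up_mono r (r + i) (leq_addr _ _).
    have := down_mono r (r + i) (leq_addr _ _); lia.
  by move/(_ (u - r)); rewrite subnKC // => ->.
apply/orP; left.
have: forall i, i <= r -> hnat k.+2 n r <= hnat k.+2 n (r - i).
  elim=> [|i IH] le_i; first by rewrite subn0.
  apply: leq_trans (IH (ltnW le_i)) _.
  have le_n : r - i.+1 < n by lia.
  have := step _ le_n; have := up_mono (r - i.+1) r (leq_subr _ _).
  have := down_mono (r - i.+1) r (leq_subr _ _).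
  by rewrite subnSK //; lia.
by move/(_ (r - l)); rewrite leq_subr subKn // => ->.
Qed.

Lemma leq_card_bigcup (I T : finType) (P : pred I) (F : I -> {set T}) :
  #|\bigcup_(i | P i) F i| <= \sum_(i | P i) #|F i|.
Proof.
elim/big_ind2: _ => [|A a B b leA leB|//]; first by rewrite cards0.
by apply: leq_trans (leq_card_setU _ _) (leq_add leA leB).
Qed.

(** A clique either avoids $B$ or consists of some $v \in B$ and neighbours of
$v$. *)
Lemma card_cliques_le (G : sgraph) (B : {set G}) (m k : nat) :
  0 < k -> (forall v, v \in B -> #|nbh v| <= m) ->
  #|cliques G k| <= 'C(nverts G - #|B|, k) + #|B| * 'C(m, k.-1).
Proof.
move=> k0 degB.
pose star v := [set S in cliques G k | v \in S].
pose away := [set S : {set G} | S \subset ~: B & #|S| == k].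
have sub : cliques G k \subset away :|: \bigcup_(v in B) star v.
  apply/subsetP=> S Sk; rewrite inE; have [//|] := boolP (S \in away).
  rewrite inE; have -> : #|S| == k by move: Sk; rewrite inE => /andP[].
  rewrite andbT => /subsetPn[v vS]; rewrite inE negbK => vB.
  by apply/bigcupP; exists v => //; rewrite inE Sk.
apply: leq_trans (subset_leq_card sub) _.
apply: leq_trans (leq_card_setU _ _) _; apply: leq_add.
  rewrite /away cards_draws.
  by rewrite -(cardsCG B) addKn.
apply: leq_trans (leq_card_bigcup _ _) _.
rewrite -sum_nat_const; apply: leq_sum => v vB.
apply: leq_trans (leq_bin2l _ (degB v vB)); rewrite -cards_draws.
have inj : {in star v &, injective (fun S => S :\ v)}.
  move=> S S'; rewrite !inE => /andP[_ vS] /andP[_ vS'] eqD.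
  by rewrite -(setD1K vS) eqD setD1K.
rewrite -(card_in_imset inj); apply/subset_leq_card/subsetP => _ /imsetP[S + ->].
rewrite !inE => /andP[/andP[/eqP cS /cliqueP clS] vS]; apply/andP; split.
  apply/subsetP=> w; rewrite !inE => /andP[nwv wS].
  by apply: clS => //; rewrite eq_sym.
by rewrite -cS (cardsD1 v S) vS.
Qed.

Definition low (G : sgraph) (j : nat) : {set G} := [set v | #|nbh v| <= j].

Lemma card_cliques_hnat (G : sgraph) (j k : nat) :
  0 < k -> j <= #|low G j| -> #|cliques G k| <= hnat k (nverts G) j.
Proof.
move=> k0 /card_geqP[s [us sz sub]].
have cs : #|[set v in s]| = j by rewrite cardsE (card_uniqP us).
rewrite /hnat -{1 2}cs; apply: card_cliques_le => // v; rewrite inE => /sub.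
by rewrite inE.
Qed.

(** With many $k$-cliques the largest $r$ admitting $r$ vertices of degree at
most $r$ leaves no freedom: those vertices are exactly $r$ in number, and the
others form a clique. Indeed a nonadjacent pair $x,y$ of vertices of larger
degree would, by Ore's bound and the choice of $r$, make all non-neighbours of
$x$ have degree at most $\lfloor (n-1)/2\rfloor$, and there are enough of them
to contradict the clique count. Convexity of $h_k$ finally leaves only two
values for $r$. *)
Lemma saturated_structure (G : sgraph) (d k : nat) (f := (nverts G).-1./2) :
    saturated G -> 2 < nverts G -> 0 < d -> (forall v : G, d <= #|nbh v|) ->
    1 < k -> hnat k (nverts G) f < #|cliques G k| ->
    (d.+1 < f -> hnat k (nverts G) d.+2 < #|cliques G k|) ->
  exists r, [/\ r = d \/ r = d.+1, r < f, #|low G r| = r & clique (~: low G r)].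
Proof.
move=> satG n2 d0 dmin k1 hf hd; have k0 := ltnW k1.
have [j0 /andP[j00 j0f] j0P] := saturated_low_degree satG n2 d0 dmin.
pose P r := (r <= f) && (r <= #|low G r|).
have exP : exists r, P r by exists j0; rewrite /P j0f.
have bP r : P r -> r <= f by case/andP.
have [r /andP[le_rf le_r] maxr] := ex_maxnP exP bP.
have r0 : 0 < r by apply: leq_trans j00 (maxr _ _); rewrite /P j0f.
have Nr j : j <= #|low G j| -> #|cliques G k| <= hnat k (nverts G) j.
  exact: card_cliques_hnat.
have lt_rf : r < f.
  rewrite ltn_neqAle le_rf andbT; apply: contraTneq (Nr _ le_r) => ->.
  by rewrite -ltnNge.
have max' j : r < j -> j <= #|low G j| -> f < j.
  move=> lt_rj le_j; rewrite ltnNge; apply: contraL lt_rj => le_jf.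
  by rewrite -leqNgt maxr // /P le_jf.
have card_r : #|low G r| = r.
  apply/eqP; rewrite eqn_leq le_r andbT -ltnS.
  have lt1 : #|low G r.+1| < r.+1.
    by rewrite ltnNge; apply/negP=> /(max' _ (ltnSn r)); rewrite ltnNge lt_rf.
  apply: leq_ltn_trans lt1; apply/subset_leq_card/subsetP => v.
  by rewrite !inE; apply: leqW.
have half_n : nverts G <= f.*2.+2.
  by have := odd_double_half (nverts G).-1; rewrite -/f; case: odd; lia.
exists r; split=> //.
  have le_dr : d <= r.
    have /card_gt0P[v] : 0 < #|low G r| by rewrite card_r.
    by rewrite inE; apply: leq_trans.
  have [|lt_d1r] := leqP r d.+1; first lia.
  have mid : d.+2 <= r <= f by rewrite lt_d1r ltnW.
  have le_fn : f <= nverts G by have := odd_double_half (nverts G).-1; rewrite -/f; lia.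
  have := hnat_convex k1 mid le_fn; rewrite leqNgt gtn_max.
  rewrite !(leq_trans _ (Nr r le_r)) //; exact: hd (ltn_trans lt_d1r lt_rf).
apply/cliqueP=> x y; rewrite !inE -!ltnNge => xD yD nxy; apply/negPn/negP=> nexy.
have key (a b : G) : a != b -> ~~ adj a b -> r < #|nbh b| ->
    #|nbh a| <= f /\ f <= nverts G - #|nbh a|.
  move=> nab neab bD.
  set r' := #|~: (a |: nbh a)|.
  have cr' : #|nbh a| + r' + 1 = nverts G.
    by have := cardsCG (a |: nbh a); rewrite cardsU1 inE adj_irr -/r'; lia.
  have sub : ~: (a |: nbh a) \subset low G r'.
    apply/subsetP=> z; rewrite !inE negb_or => /andP[nza neza].
    have := saturated_degree_sum satG n2 _ neza; rewrite eq_sym => /(_ nza); lia.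
  have /max' : r < r'.
    have := saturated_degree_sum satG n2 nab neab; lia.
  by move/(_ (subset_leq_card sub)); lia.
have [xf xn] := key x y nxy nexy yD.
suff /Nr : f <= #|low G f| by rewrite leqNgt hf.
have sub : ~: (nbh x) \subset low G f.
  apply/subsetP=> z; rewrite !inE => nexz.
  have [->|nzx] := eqVneq z x; first exact: xf.
  have [le_zr|lt_rz] := leqP #|nbh z| r; first by apply: leq_trans le_zr _.
  by case: (key z x); rewrite // adj_sym.
apply: leq_trans (subset_leq_card sub).
by have := cardsCG (nbh x); lia.
Qed.

(** * Hamiltonian cycles from path systems *)

Section Paths.
Variable G : sgraph.
Implicit Types (X : {set G}) (p Q : seq G).

Definition pathin X p := [&& uniq p, all (mem X) p & sorted (@adj G) p].

Definition nbh_in X (v : G) : {set G} := nbh v :&: X.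

Lemma pathin_sub X p : pathin X p -> {subset p <= X}.
Proof. by case/and3P=> _ /allP. Qed.

Lemma pathin_uniq X p : pathin X p -> uniq p.
Proof. by case/and3P. Qed.

Lemma pathin_rev X p : pathin X p -> pathin X (rev p).
Proof.
case/and3P=> up ap sp; rewrite /pathin rev_uniq up all_rev ap rev_sorted.
by rewrite (@eq_sorted _ _ (@adj G)) // => a b; apply: adj_sym.
Qed.

End Paths.

Lemma uniq_disjoint_cat (T : eqType) (p e : seq T) : uniq p -> uniq e ->
  (forall u, u \in e -> u \notin p) -> uniq (p ++ e).
Proof. by move=> up ue h; rewrite cat_uniq up ue andbT; apply/hasPn. Qed.

Lemma perm_mid (T : eqType) (s : T) A B : perm_eq (A ++ s :: B) (s :: A ++ B).
Proof. by have := perm_catCA A [:: s] B => ->. Qed.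

Lemma perm_two (T : eqType) (t t' y : T) A B F :
  perm_eq ((A ++ B ++ F) ++ [:: t; t'; y]) (t :: A ++ F ++ y :: rcons B t').
Proof.
apply/permP=> f; rewrite -cats1 /= !count_cat /= !count_cat /=.
move: (f t : nat) (f t' : nat) (f y : nat) => a b c; lia.
Qed.

Lemma perm_double_chain (T : eqType) (v1 v2 v3 v4 t1 t2 t3 t4 s1 s2 : T) :
  perm_eq ([:: v1; v2; v3; v4] ++ [:: t1; t2; t3; t4] ++ [:: s1; s2])
    [:: t1, v1, s1, v2, t2, t3, v3, s2, v4 & [:: t4]].
Proof.
apply/permP=> f /=.
move: (f v1 : nat) (f v2 : nat) (f v3 : nat) (f v4 : nat) => a1 a2 a3 a4.
move: (f t1 : nat) (f t2 : nat) (f t3 : nat) (f t4 : nat) => b1 b2 b3 b4.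
by move: (f s1 : nat) (f s2 : nat) => c1 c2; lia.
Qed.

Section Weave.
Variables (G : sgraph) (D S : {set G}).
Hypotheses (n2 : 2 < nverts G) (clC : clique (~: D)).
Hypotheses (SD : {subset S <= ~: D}).
Hypotheses (adjSD : forall a v, a \in S -> v \in D -> adj a v).
Implicit Types (p Q : seq G).

Let SnD a : a \in S -> a \notin D.
Proof. by move/SD; rewrite inE. Qed.

(** Vertices of $S$ are adjacent to all of $D$, hence each can link the ends of
two paths in $D$. *)
Lemma weave_seq x p (Qs : seq (seq G)) ss y p2 :
  x \notin D -> last x p \in D -> path (@adj G) x p ->
  all (fun Q => (Q != [::]) && pathin D Q) Qs -> {subset ss <= S} ->
  size Qs <= size ss -> y \in S -> last y p2 \notin D -> path (@adj G) y p2 ->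
  uniq (x :: p ++ flatten Qs ++ ss ++ y :: p2) ->
  {subset D <= x :: p ++ flatten Qs ++ y :: p2} -> hamiltonian G.
Proof.
move=> xD; elim: Qs p ss => [|Q Qs IH] p ss lp pp.
  move=> _ sub _ yS ly py uL DL.
  apply: (@clique_path_hamiltonian _ (~: D) x (p ++ y :: p2)) => //.
  - by rewrite inE.
  - by rewrite last_cat /= inE.
  - apply: subseq_uniq uL; rewrite /= eqxx.
    by apply: cat_subseq; rewrite ?suffix_subseq.
  - by rewrite cat_path pp /= adj_sym adjSD.
  - by move=> v; rewrite inE negbK => /DL.
case: ss => // s ss; rewrite [all _ _]/= => /andP[/andP[Q0 /and3P[uQ /allP QD sQ]] aQs].
move=> sub sz yS ly py uL DL.
have sS : s \in S by apply: sub; rewrite mem_head.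
case: Q Q0 uQ QD sQ uL DL sz => // h Q _ uQ QD sQ uL DL sz.
apply: (IH (p ++ s :: h :: Q) ss) => //.
- by rewrite last_cat /=; apply: QD; apply: mem_last.
- rewrite cat_path pp /= (sQ : path _ h Q) adj_sym !adjSD //.
  by apply: QD; apply: mem_head.
- by move=> v vss; apply: sub; rewrite inE vss orbT.
- move: uL; rewrite (_ : flatten (_ :: _) = (h :: Q) ++ flatten Qs) //.
  rewrite (@perm_uniq _ _ (x :: (p ++ s :: h :: Q) ++ flatten Qs ++ ss ++ y :: p2)) //.
  rewrite perm_cons -!catA perm_cat2l catA; apply: perm_trans (perm_mid _ _ _) _.
  by rewrite -catA.
- move=> v /DL; rewrite (_ : flatten (_ :: _) = (h :: Q) ++ flatten Qs) //.
  by rewrite !(inE, mem_cat); do ![case/orP]; move=> ->; rewrite ?orbT.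
Qed.

(** The vertices of $D$ on none of the given paths are paths with one vertex, and
every path of the system costs one more vertex of $S$. *)
Lemma weave x p (Qs : seq (seq G)) y p2 (L := x :: p ++ flatten Qs ++ y :: p2) :
  x \notin D -> last x p \in D -> path (@adj G) x p ->
  all (fun Q => (Q != [::]) && pathin D Q) Qs ->
  y \in S -> last y p2 \notin D -> path (@adj G) y p2 -> uniq L ->
  #|D :\: [set z in L]| + size Qs <= #|S :\: [set z in L]| -> hamiltonian G.
Proof.
move=> xD lp pp aQs yS ly py uL le.
pose R := D :\: [set z in L]; pose ss := enum (S :\: [set z in L]).
have fl : flatten [seq [:: r] | r <- enum R] = enum R.
  by elim: (enum R) => //= a l ->.
apply: (@weave_seq x p (Qs ++ [seq [:: r] | r <- enum R]) ss y p2) => //.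
- rewrite all_cat aQs all_map; apply/allP=> r; rewrite mem_enum inE => /andP[_ rD] /=.
  by rewrite /pathin /= rD.
- by move=> v; rewrite mem_enum inE => /andP[].
- by rewrite size_cat size_map -!cardE addnC.
- have perm : perm_eq (L ++ enum R ++ ss) (x :: p ++ flatten (Qs ++ [seq [:: r] | r <- enum R]) ++ ss ++ y :: p2).
    rewrite flatten_cat fl /L cat_cons perm_cons -!catA !perm_cat2l.
    by rewrite perm_catC -catA.
  rewrite -(perm_uniq perm) cat_uniq uL cat_uniq !enum_uniq /= andbT.
  apply/andP; split; apply/hasPn=> v; rewrite ?mem_cat !mem_enum !inE.
    by case/orP=> /andP[].
  by case/andP=> _ /SnD /negPf->; rewrite andbF.
move=> v vD; rewrite flatten_cat fl -catA.
have [vL|vL] := boolP (v \in L).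
  by move: vL; rewrite /L !(inE, mem_cat); do ![case/orP]; move=> ->; rewrite ?orbT.
by rewrite inE !mem_cat mem_enum inE inE vL vD !orbT.
Qed.

Lemma card_seq_sub (B : {set G}) (L : seq G) : uniq L ->
  #|B :&: [set z in L]| = size [seq z <- L | z \in B].
Proof.
move=> uL; rewrite -(card_uniqP (filter_uniq _ uL)); apply/eq_card => z.
by rewrite !inE mem_filter.
Qed.

Lemma card_setD_seq (B : {set G}) (L : seq G) : uniq L ->
  #|B :\: [set z in L]| = #|B| - count (mem B) L.
Proof.
by move=> uL; rewrite cardsD card_seq_sub // size_filter; congr (_ - _); apply: eq_count.
Qed.

Lemma count_all_in (B : {set G}) (L : seq G) : {subset L <= B} -> count (mem B) L = size L.
Proof. by move=> sub; apply/eqP; rewrite -all_count; apply/allP. Qed.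

Lemma count_all_out (B : {set G}) (L : seq G) :
  (forall v, v \in L -> v \notin B) -> count (mem B) L = 0.
Proof.
move=> sub; apply/eqP; rewrite -leqn0 leqNgt -has_count; apply/hasPn => v /sub.
exact.
Qed.

Lemma flatten_sub (Qs : seq (seq G)) :
  all (fun Q => (Q != [::]) && pathin D Q) Qs -> {subset flatten Qs <= D}.
Proof.
move=> aQs v /flattenP[Q /(allP aQs) /andP[_ /pathin_sub sub]]; exact: sub.
Qed.

(** The first path is entered from $z$, which may but need not lie in $S$; the
last path is left through a vertex of $S$. *)
Lemma weave_one_end z h p Qs :
  z \notin D -> adj z h -> all (fun Q => (Q != [::]) && pathin D Q) ((h :: p) :: Qs) ->
  uniq (flatten ((h :: p) :: Qs)) ->
  #|D| + (size Qs).+1 <= #|S :\ z| + size (flatten ((h :: p) :: Qs)) ->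
  hamiltonian G.
Proof.
move=> zD zh aQs uQs le; have sub := flatten_sub aQs.
have le_D : size (flatten ((h :: p) :: Qs)) <= #|D|.
  by rewrite -(card_uniqP uQs); apply/subset_leq_card/subsetP.
have /card_gt0P[y] : 0 < #|S :\ z| by clear -le le_D; lia.
rewrite !inE => /andP[nyz yS].
case/andP: (aQs) => /andP[_ /and3P[uhp /allP hpD shp]] aQs'.
have yD := SnD yS.
have nL v : v \notin D -> v \notin flatten ((h :: p) :: Qs) by apply: contra; apply: sub.
set F := flatten _ in sub uQs le le_D nL.
have eqL : z :: (h :: p) ++ flatten Qs ++ [:: y] = z :: F ++ [:: y] by rewrite catA.
have uL : uniq (z :: F ++ [:: y]).
  rewrite cons_uniq mem_cat mem_seq1 [z == y]eq_sym (negPf nyz) (negPf (nL _ zD)) cats1 rcons_uniq.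
  by rewrite (negPf (nL _ yD)) uQs.
apply: (@weave z (h :: p) Qs y [::]); rewrite ?eqL //.
- by apply: hpD; rewrite /= mem_last.
- by rewrite /= zh.
clearbody F; rewrite !card_setD_seq // -cat1s !count_cat (count_all_in sub) (@count_all_out S F).
  rewrite /= (negPf zD) (negPf yD) yS; have := cardsD1 z S.
  by clear -le le_D; lia.
by move=> v /sub; apply: contraL; apply: SnD.
Qed.

(** With vertices outside $S$ available at both ends of the system, one vertex of
$S$ fewer is needed. *)
Lemma weave_two_ends t h p Qs h' p' t' :
  t \notin D :|: S -> t' \notin D :|: S -> t != t' -> adj t h -> adj (last h' p') t' ->
  all (fun Q => (Q != [::]) && pathin D Q) ((h :: p) :: (h' :: p') :: Qs) ->
  uniq (flatten ((h :: p) :: (h' :: p') :: Qs)) ->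
  #|D| + (size Qs).+1 <= #|S| + size (flatten ((h :: p) :: (h' :: p') :: Qs)) ->
  hamiltonian G.
Proof.
rewrite !inE !negb_or => /andP[tD tS] /andP[tD' tS'] ntt th th' aQs uQs le.
have sub := flatten_sub aQs.
have le_D : size (flatten ((h :: p) :: (h' :: p') :: Qs)) <= #|D|.
  by rewrite -(card_uniqP uQs); apply/subset_leq_card/subsetP.
have /card_gt0P[y yS] : 0 < #|S| by clear -le le_D; lia.
case/and3P: (aQs) => /andP[_ /and3P[uhp /allP hpD shp]] /andP[_ /and3P[uhp' /allP hpD' shp']] aQs'.
have yD := SnD yS; set F := flatten _ in sub uQs le le_D.
have nL v : v \notin D -> v \notin F by apply: contra; apply: sub.
set L := t :: (h :: p) ++ flatten Qs ++ y :: h' :: rcons p' t'.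
have perm : perm_eq (F ++ [:: t; t'; y]) L.
  exact: perm_two.
have uL : uniq L.
  rewrite -(perm_uniq perm) cat_uniq; apply/and3P; split=> //.
    by apply/hasPn=> v; rewrite !inE => /or3P[] /eqP->; apply: nL.
  rewrite /= !inE negb_or ntt /= andbT; apply/andP; split.
    by apply: contraNneq tS => ->.
  by apply: contraNneq tS' => ->.
apply: (@weave t (h :: p) Qs y (h' :: rcons p' t')) => //.
- by apply: hpD; rewrite /= mem_last.
- by rewrite /= th.
- by rewrite /= last_rcons.
- by rewrite /= rcons_path (shp' : path _ _ _) th' adjSD //; apply: hpD'; apply: mem_head.
rewrite -[t :: _ ++ _]/L; clearbody F L; rewrite !card_setD_seq // -!(permP perm) !count_cat (count_all_in sub) /=.
rewrite (@count_all_out S F); last by move=> v /sub; apply: contraL; apply: SnD.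
by rewrite (negPf tD) (negPf tD') (negPf yD) (negPf tS) (negPf tS') yS;
  clear -le le_D; lia.
Qed.

End Weave.

(** * Longest paths *)

Lemma longest_seq (T : finType) (P : pred (seq T)) p0 :
  P p0 -> (forall p, P p -> uniq p) ->
  exists2 p, P p & forall p', P p' -> size p' <= size p.
Proof.
move=> Pp0 uP; pose Q m := [exists t : m.-tuple T, P t].
have QP m : reflect (exists2 p, P p & size p = m) (Q m).
  apply: (iffP existsP) => [[t Pt]|[p Pp sz]]; first by exists t; rewrite ?size_tuple.
  by exists (Tuple (introT eqP sz)).
have exQ : exists m, Q m by exists (size p0); apply/QP; exists p0.
have bQ m : Q m -> m <= #|T|.
  by case/QP=> p /uP up <-; rewrite -(card_uniqP up) max_card.
have [m /QP[p Pp sz] maxm] := ex_maxnP exQ bQ.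
by exists p => // p' Pp'; rewrite sz; apply: maxm; apply/QP; exists p'.
Qed.

Section Longest.
Variable G : sgraph.
Implicit Types (X : {set G}) (p : seq G).

Definition max_from X x p :=
  pathin X (x :: p) /\ forall p', pathin X (x :: p') -> size p' <= size p.

Lemma pathin_rcons X x p v : pathin X (x :: p) -> v \in X -> v \notin x :: p ->
  adj (last x p) v -> pathin X (x :: rcons p v).
Proof.
case/and3P=> up ap sp vX vp lv.
by rewrite -rcons_cons /pathin rcons_uniq vp up all_rcons [mem X v]vX ap /= rcons_path (sp : path _ _ _).
Qed.

Lemma max_from_end X x p : max_from X x p -> nbh_in X (last x p) \subset x :: p.
Proof.
case=> pp maxp; apply/subsetP=> v; rewrite !inE => /andP[lv vX].
apply/negPn/negP=> vp; have := maxp (rcons p v).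
rewrite size_rcons ltnn => h; suff: false by [].
by apply: h; apply: pathin_rcons; rewrite // inE.
Qed.

Lemma max_from_sub X x p : max_from X x p ->
  nbh_in X (last x p) \subset [set w in x :: p] :\ last x p.
Proof.
move=> maxp; have sub := max_from_end maxp.
apply/subsetP=> w wN; have := subsetP sub w wN; rewrite !inE => ->.
by rewrite andbT; move: wN; apply: contraTneq => ->; rewrite !inE adj_irr.
Qed.

Lemma card_path_minus_last x p : uniq (x :: p) -> #|[set w : G in x :: p] :\ last x p| = size p.
Proof.
move=> up; have := cardsD1 (last x p) [set w in x :: p].
by rewrite inE mem_last cardsE (card_uniqP up) /= => -[].
Qed.

Lemma max_from_card X x p : max_from X x p -> #|nbh_in X (last x p)| <= size p.
Proof.
move=> maxp; case: (maxp) => /and3P[up _ _] _.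
by rewrite -(card_path_minus_last up); apply/subset_leq_card/max_from_sub.
Qed.

(** If the end of a longest path has enough neighbours on it, it is adjacent to
all other vertices of the path. Reversing a final segment then makes any
other vertex, except the root, the end of a longest path. *)
Lemma max_from_rotate X x p y : max_from X x p ->
  size p <= #|nbh_in X (last x p)| -> y \in p ->
  exists p', [/\ max_from X x p', perm_eq p' p & last x p' = y].
Proof.
move=> maxp le_p yp; have sub := max_from_sub maxp.
case: (maxp) => /and3P[up ap sp] max.
have adjl z : z \in x :: p -> z != last x p -> adj (last x p) z.
  move=> zp nzl.
  have /eqP eqN : nbh_in X (last x p) == [set w in x :: p] :\ last x p.
    by rewrite eqEcard sub card_path_minus_last.
  have : z \in nbh_in X (last x p) by rewrite eqN !inE nzl -in_cons.
  by rewrite !inE => /andP[].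
case/splitPr: yp maxp le_p sub up ap sp max adjl => p1 p2 maxp _ _ up ap sp max adjl.
have perm : perm_eq (p1 ++ rev (y :: p2)) (p1 ++ y :: p2).
  by rewrite perm_cat2l perm_rev.
exists (p1 ++ rev (y :: p2)); split=> //; last first.
  by rewrite rev_cons last_cat last_rcons.
have permx : perm_eq (x :: p1 ++ rev (y :: p2)) (x :: p1 ++ y :: p2) by rewrite perm_cons.
split; last by rewrite (perm_size perm).
rewrite /pathin (perm_uniq permx) up (perm_all _ permx) ap /= cat_path.
move: sp; rewrite /= cat_path => /andP[-> pyp] /=.
case: (lastP p2) up adjl pyp => [|q z] up adjl pyp; first by case/andP: pyp => h _; rewrite /rev /= h.
have lz : last x (p1 ++ y :: rcons q z) = z by rewrite last_cat /= last_rcons.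
rewrite rev_cons rev_rcons rcons_cons /= -rev_cons.
have -> : adj (last x p1) z.
  rewrite adj_sym -lz; apply: adjl; rewrite ?lz.
    by rewrite -cat_cons mem_cat mem_last.
  move: up; rewrite -cat_cons cat_uniq => /and3P[_ /hasPn/(_ z) + _].
  rewrite inE mem_rcons mem_head orbT => /(_ isT).
  by apply: contraNneq => <-; apply: mem_last.
have := rev_path (@adj G) y (rcons q z); rewrite last_rcons belast_rcons => ->.
rewrite (@eq_path _ _ (@adj G)) => [|a b]; last exact: adj_sym.
by case/andP: pyp.
Qed.

Lemma max_from_closed X x p y : max_from X x p ->
  size p <= #|nbh_in X (last x p)| -> y \in p -> nbh_in X y \subset x :: p.
Proof.
move=> maxp le_p yp; have [p' [maxp' perm <-]] := max_from_rotate maxp le_p yp.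
apply: subset_trans (max_from_end maxp') _.
by apply/subsetP=> z; rewrite !inE (perm_mem perm).
Qed.

Definition longest X p := pathin X p /\ forall p', pathin X p' -> size p' <= size p.

Lemma longest_max_from X x p : longest X (x :: p) -> max_from X x p.
Proof. by case=> pp max; split=> // p' /max. Qed.

Lemma longest_rev X p : longest X p -> longest X (rev p).
Proof. by case=> pp max; split; rewrite ?size_rev //; apply: pathin_rev. Qed.

Lemma exists_longest X v : v \in X -> exists x p, longest X (x :: p).
Proof.
move=> vX; have pv : pathin X [:: v] by rewrite /pathin /= vX.
have [|p pp maxp] := longest_seq pv; first by move=> p /and3P[].
case: p pp maxp => [|x p] pp maxp; first by have := maxp _ pv.
by exists x, p.
Qed.

Lemma longest_head X x p : longest X (x :: p) -> nbh_in X x \subset x :: p.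
Proof.
move=> lp; have := longest_rev lp; case def: (rev (x :: p)) => [|y q] lq.
  by move/(congr1 size): def; rewrite size_rev.
have := max_from_end (longest_max_from lq).
have -> : last y q = x by rewrite -(last_cons x) -def rev_cons last_rcons.
by move=> /subset_trans; apply; rewrite -def; apply/subsetP => z; rewrite mem_rev.
Qed.

Lemma longest_closed X x p y : longest X (x :: p) ->
  size p <= #|nbh_in X (last x p)| -> y \in x :: p -> nbh_in X y \subset x :: p.
Proof.
move=> lp le /predU1P[->|]; first exact: longest_head.
exact: max_from_closed (longest_max_from lp) le.
Qed.

Lemma exists_notin X p : uniq p -> size p < #|X| -> exists2 z, z \in X & z \notin p.
Proof.
move=> up lt; suff /subsetPn[z] : ~~ (X \subset [set w in p]).
  by rewrite inE; exists z.
apply: contraL lt => /subset_leq_card; rewrite cardsE (card_uniqP up).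
by rewrite -leqNgt.
Qed.

Lemma pathin_edge X z w : z \in X -> w \in X -> adj z w -> pathin X [:: z; w].
Proof.
move=> zX wX zw; have nzw : z != w by apply: contraTneq zw => ->; rewrite adj_irr.
by rewrite /pathin /= inE nzw zX wX zw.
Qed.

Lemma pathin3 X (a b c : G) : a \in X -> b \in X -> c \in X -> adj a b -> adj b c ->
  a != c -> pathin X [:: a; b; c].
Proof.
move=> aX bX cX ab bc nac; rewrite /pathin /= !inE aX bX cX ab bc negb_or nac !andbT.
by apply/andP; split; [apply: contraTneq ab|apply: contraTneq bc] => ->; rewrite adj_irr.
Qed.

(** A graph of minimum degree at least $q$ on at least $q+2$ vertices contains a
linear forest with $q+1$ edges: a longest path has at least $q$ edges, and
if it has no more then its vertices have no neighbours outside it. *)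
Lemma linear_forest X q : 0 < q -> q.+1 < #|X| ->
    (forall v, v \in X -> q <= #|nbh_in X v|) ->
  (exists2 p, pathin X p & q.+1 < size p) \/
  (exists p e, [/\ pathin X p, pathin X e, uniq (p ++ e), size p = q.+1 & size e = 2]).
Proof.
move=> q0 lt_q deg; have /card_gt0P[v vX] : 0 < #|X| by lia.
have [x [p lp]] := exists_longest vX; have [pp _] := lp.
have lX : last x p \in X by apply: (pathin_sub pp); apply: mem_last.
have maxp := longest_max_from lp.
have le_q := leq_trans (deg _ lX) (max_from_card maxp).
have [|lt_p] := ltnP q (size p); first by left; exists (x :: p).
right; have sz : size p = q by apply/eqP; rewrite eqn_leq lt_p.
have up : uniq (x :: p) by case/and3P: pp.
have [|z zX zp] := @exists_notin X (x :: p) up; first by rewrite /= sz.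
have /card_gt0P[w] : 0 < #|nbh_in X z| by apply: leq_trans (deg z zX).
rewrite !inE => /andP[zw wX].
have wp : w \notin x :: p.
  apply: contra zp => wp.
  have /subsetP := longest_closed lp (leq_trans lt_p (deg _ lX)) wp.
  by apply; rewrite !inE adj_sym zw zX.
have pe := pathin_edge zX wX zw.
exists (x :: p), [:: z; w]; split=> //; last by rewrite /= sz.
rewrite cat_uniq up; case/and3P: pe => -> _ _; rewrite andbT.
by apply/hasPn=> u; rewrite !inE => /orP[] /eqP->; rewrite -in_cons.
Qed.

End Longest.

(** * Hamiltonicity when a small set is joined to a clique *)

Section Cases.
Variables (G : sgraph) (D S : {set G}) (q : nat).
Hypotheses (n2 : 2 < nverts G) (clC : clique (~: D)).
Hypotheses (SD : {subset S <= ~: D}).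
Hypotheses (adjSD : forall a v, a \in S -> v \in D -> adj a v).
Hypothesis q0 : 0 < q.

Let SnD a : a \in S -> a \notin D.
Proof. by move/SD; rewrite inE. Qed.

Let N := nbh_in D.

Let card_S1 a : a \in S -> #|S :\ a| = #|S|.-1.
Proof. by move=> aS; have := cardsD1 a S; rewrite aS => ->. Qed.

Let card_S0 a : a \notin S -> #|S :\ a| = #|S|.
Proof. by move=> aS; have := cardsD1 a S; rewrite (negPf aS). Qed.

(** A linear forest in $D$ with $q+1$ edges leaves $|S|-1$ paths to link. *)
Lemma regular_hamiltonian : 1 < #|S| -> #|D| = q + #|S| ->
  (forall v, v \in D -> q <= #|N v|) -> hamiltonian G.
Proof.
move=> s2 cD deg; have /card_gt0P[s0 s0S] : 0 < #|S| by apply: ltnW.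
have le : q.+1 < #|D| by rewrite cD -(addn1 q) -addnS leq_add2l.
have c1 := card_S1 s0S.
case: (linear_forest q0 le deg) => [[p pp sz]|[p [e [pp pe ue szp sze]]]].
  case: p pp sz => // h p pp sz; have hD : h \in D by apply: (pathin_sub pp); apply: mem_head.
  apply: (@weave_one_end G D S n2 clC SD adjSD s0 h p [::]) => //.
  - exact: SnD.
  - exact: adjSD.
  - by rewrite /= pp.
  - by rewrite /= cats0; case/and3P: pp.
  - by rewrite /= cats0 c1 cD; clear -s2 sz; move: sz => /=; lia.
case: p pp ue szp => // h p pp ue szp; have hD : h \in D by apply: (pathin_sub pp); apply: mem_head.
apply: (@weave_one_end G D S n2 clC SD adjSD s0 h p [:: e]) => //.
- exact: SnD.
- exact: adjSD.
- by rewrite /= pp pe; case: (e) sze.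
- by rewrite /= cats0.
- rewrite /= cats0 size_cat sze c1 cD; clear -s2 szp; move: szp => /=; lia.
Qed.

Let mem_N u v : (u \in N v) = adj v u && (u \in D).
Proof. by rewrite !inE. Qed.

Let in_N u v : adj v u -> u \in D -> u \in N v.
Proof. by move=> h uD; rewrite mem_N h. Qed.

(** With one more vertex in $D$, a linear forest with $q+2$ edges is needed. A
longest path has at least $q$ edges. If it has $q+1$, then a vertex off the path
has either a neighbour off the path, or so many on it that the path can be
made longer. If it has $q$, then no edge leaves it, and a path with two edges
elsewhere completes the forest, unless $D$ induces a matching. *)
Lemma nearly_regular_hamiltonian : 1 < #|S| -> #|D| = (q + #|S|).+1 ->
  (forall v, v \in D -> q <= #|N v| <= q.+1) ->
  hamiltonian G \/ [/\ q = 1, #|S| = 2 & forall v, v \in D -> #|N v| = 1].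
Proof.
move=> s2 cD deg'; have /card_gt0P[s0 s0S] : 0 < #|S| by apply: ltnW.
have deg v : v \in D -> q <= #|N v| by move/deg'/andP=> [].
have c1 := card_S1 s0S; have s0D := SnD s0S.
have /card_gt0P[v0 v0D] : 0 < #|D| by rewrite cD.
have [x [p lp]] := exists_longest v0D; have [pp maxl] := lp.
have maxp := longest_max_from lp.
have xD : x \in D by apply: (pathin_sub pp); apply: mem_head.
have lD : last x p \in D by apply: (pathin_sub pp); apply: mem_last.
have up := pathin_uniq pp.
have sx := adjSD s0S xD.
have le_q : q <= size p := leq_trans (deg _ lD) (max_from_card maxp).
(* Two disjoint paths with $m$ vertices leave $|D|-m+2$ paths to link, which
   takes $|D|-m+3$ vertices of $S$: there are enough once $m \ge q+4$. *)
have two e : pathin D e -> e != [::] -> (forall u, u \in e -> u \notin x :: p) ->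
    q + 3 <= size p + size e -> hamiltonian G.
  move=> pe ne de sze.
  apply: (@weave_one_end G D S n2 clC SD adjSD s0 x p [:: e]) => //.
  - by rewrite /= pp pe ne.
  - by rewrite /= cats0; apply: (uniq_disjoint_cat up (pathin_uniq pe) de).
  - rewrite /= cats0 size_cat c1 cD; clear -s2 sze; lia.
have [big|small] := ltnP q.+1 (size p).
  left; apply: (@weave_one_end G D S n2 clC SD adjSD s0 x p [::]) => //.
  - by rewrite /= pp.
  - by rewrite /= cats0.
  - rewrite /= cats0 c1 cD; clear -s2 big; lia.
have [z zD zp] : exists2 z, z \in D & z \notin x :: p.
  by apply: exists_notin => //; rewrite cD /=; clear -s2 small; lia.
move: small; rewrite leq_eqVlt => /orP[/eqP sz|].
- have [/exists_inP[w wN wp]|/exists_inPn none] := boolP [exists (w | w \in N z), w \notin x :: p].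
    move: wN; rewrite mem_N => /andP[zw wD]; left.
    apply: (two [:: z; w]) => //; first exact: pathin_edge.
      by move=> u; rewrite !inE => /orP[] /eqP ->; rewrite -in_cons.
    by rewrite sz /=; clear; lia.
  have nx : x \notin N z.
    rewrite mem_N xD andbT; apply: contra zp => zx.
    by have /subsetP := longest_head lp; apply; rewrite !inE adj_sym zx.
  have nl : last x p \notin N z.
    rewrite mem_N lD andbT; apply: contra zp => zx.
    by have /subsetP := max_from_end maxp; apply; rewrite !inE adj_sym zx.
  (* All $q$ neighbours of $z$ are among the $q$ inner vertices of the path. *)
  have inner w : w \in p -> w != last x p -> w \in N z.
    have subN : N z \subset ([set w in x :: p] :\ last x p) :\ x.
      apply/subsetP=> u uN; rewrite !inE.
      have := none u uN; rewrite negbK inE => ->; rewrite andbT.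
      by apply/andP; split; apply: contraTneq uN => ->.
    have p0 : 0 < size p by rewrite sz.
    have nxl : x != last x p.
      case: (p) p0 up => // a p' _ /= /andP[xn _].
      by apply: contraNneq xn => ->; apply: mem_last.
    have card' : #|([set w in x :: p] :\ last x p) :\ x| = q.
      have := cardsD1 x ([set w in x :: p] :\ last x p).
      by rewrite card_path_minus_last // !inE nxl eqxx sz /= => -[].
    have /eqP eqN : N z == ([set w in x :: p] :\ last x p) :\ x.
      by rewrite eqEcard subN card' deg.
    move=> wp nwl; rewrite eqN !inE nwl wp orbT !andbT.
    by case/andP: up => xp _; apply: contraNneq xp => <-.
  case: p lp maxl maxp pp lD up le_q two sz zp none nl inner => [|a [|b p]].
  - by move=> _ _ _ _ _ _ _ _ /=; clear -q0; lia.
  - by move=> _ _ _ _ _ _ _ _ /= [qq]; move: q0; rewrite -qq.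
  move=> lp maxl maxp pp lD up _ _ sz zp none nl inner.
  case/and3P: (pp) => _ /and4P[_ aD bD pD] /and3P[xa ab bp].
  have {}aD : a \in D := aD; have {}bD : b \in D := bD.
  have anl : a != last x [:: a, b & p].
    by move: up => /and3P[_ + _]; apply: contraNneq => ->; rewrite /= mem_last.
  have za : a \in N z by apply: inner; rewrite ?mem_head.
  have za' : adj z a by move: za; rewrite mem_N => /andP[].
  case: p lp maxl maxp pp lD up sz zp none nl inner bp pD anl => [|c p].
    (* For $q = 1$ the middle vertex $a$ would have three neighbours. *)
    move=> _ _ _ pp _ up [q1] zp _ _ _ _ _ _; exfalso.
    have /andP[_] := deg' a aD; rewrite -q1 leqNgt; case/negP.
    apply/card_geqP; exists [:: x; b; z]; split=> //.
      move: up zp; rewrite /= !inE !negb_or => /and3P[/andP[_ ->] _ _] /and3P[zx _ zb].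
      by rewrite ![_ == z]eq_sym zx zb.
    by move=> u; rewrite !inE => /or3P[] /eqP->; rewrite ?xD ?bD ?zD andbT // adj_sym.
  move=> lp maxl maxp pp lD up sz zp none nl inner bp pD anl.
  have zb' : adj z b.
    have : b \in N z.
      apply: inner; first by rewrite !inE eqxx orbT.
      by case/and4P: up => _ _ + _; apply: contraNneq => ->; rewrite /= mem_last.
    by rewrite mem_N => /andP[].
  (* Otherwise $z$ can be inserted between $a$ and $b$. *)
  exfalso; suff /maxl : pathin D [:: x, a, z, b, c & p] by rewrite /= ltnn.
  case/and3P: (pp) => _ allp _; apply/and3P; split.
  - have -> : uniq [:: x, a, z, b, c & p] = uniq [:: z, x, a, b, c & p].
      exact: (perm_uniq (perm_mid z [:: x; a] [:: b, c & p])).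
    by rewrite cons_uniq zp.
  - by move: allp => /= /and3P[-> -> ->]; rewrite !andbT; apply: zD.
  - by rewrite /= xa adj_sym za' zb'.
rewrite ltnS => le_pq.
have sz : size p = q by apply/eqP; rewrite eqn_leq le_pq.
have clos w : w \in x :: p -> N w \subset x :: p.
  by apply: longest_closed lp (leq_trans le_pq (deg _ lD)).
have out w w' : w \notin x :: p -> w' \in N w -> w \in D -> w' \notin x :: p.
  rewrite mem_N => wp /andP[ww' w'D] wD; apply: contra wp => /clos /subsetP; apply.
  by rewrite mem_N adj_sym ww'.
have [q1|q2] : q = 1 \/ 1 < q by clear -q0; lia.
  have deg1 w : w \in D -> #|N w| = 1.
    move=> wD; apply/eqP; rewrite eqn_leq -{2}q1 deg // andbT leqNgt.
    apply/negP=> /card_gt1P[a [b [aN bN nab]]].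
    move: aN bN; rewrite !mem_N => /andP[wa aD] /andP[wb bD].
    have /maxl : pathin D [:: a; w; b] by apply: pathin3; rewrite // adj_sym.
    by rewrite /= sz q1.
  have [s_eq|s3] : #|S| = 2 \/ 2 < #|S| by clear -s2; lia.
    by right.
  left; have /card_gt0P[w wN] : 0 < #|N z| by rewrite deg1.
  have wp := out z w zp wN zD; move: (wN); rewrite mem_N => /andP[zw wD].
  have pzw := pathin_edge zD wD zw.
  have u4 : uniq ((x :: p) ++ [:: z; w]).
    apply: uniq_disjoint_cat up (pathin_uniq pzw) _ => u.
    by rewrite !inE => /orP[] /eqP->; rewrite -in_cons.
  (* $D$ induces a perfect matching, of which three edges are enough. *)
  have [|y yD y4] := @exists_notin G D ((x :: p) ++ [:: z; w]) u4.
    by rewrite size_cat /= sz q1 cD; clear -s3 q1; lia.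
  have /card_gt0P[y' y'N] : 0 < #|N y| by rewrite deg1.
  move: (y4); rewrite mem_cat negb_or => /andP[yp yzw].
  have y'p := out y y' yp y'N yD; move: (y'N); rewrite mem_N => /andP[yy' y'D].
  have only a b c : a \in D -> b \in N a -> c \in N a -> b = c.
    by move=> /deg1/eqP/cards1P[d ->]; rewrite !inE => /eqP-> /eqP->.
  have y'zw : y' \notin [:: z; w].
    apply: contra yzw; rewrite !inE => /orP[] /eqP eqy'.
      rewrite [y == w](_ : _ = true) ?orbT //; apply/eqP; apply: (only z) => //.
      by apply: in_N; rewrite // -eqy' adj_sym.
    rewrite [y == z](_ : _ = true) //; apply/eqP; apply: (only w) => //.
      by apply: in_N; rewrite // -eqy' adj_sym.
    by apply: in_N; rewrite // adj_sym.
  have pyy' := pathin_edge yD y'D yy'.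
  apply: (@weave_one_end G D S n2 clC SD adjSD s0 x p [:: [:: z; w]; [:: y; y']]) => //.
  - by rewrite /= pp pzw pyy'.
  - rewrite (_ : flatten _ = ((x :: p) ++ [:: z; w]) ++ [:: y; y']); last by rewrite -catA.
    apply: uniq_disjoint_cat u4 (pathin_uniq pyy') _ => u.
    rewrite inE => /orP[/eqP->//|]; rewrite inE => /eqP->.
    by rewrite mem_cat negb_or y'p y'zw.
  - by rewrite c1 cD /= size_cat /= sz q1; clear -s3; lia.
left; have /card_gt1P[a [b [aN bN nab]]] : 1 < #|N z| by apply: leq_trans q2 (deg z zD).
have ap := out z a zp aN zD; have bp := out z b zp bN zD.
move: aN bN; rewrite !mem_N => /andP[za aD] /andP[zb bD].
apply: (two [:: a; z; b]) => //.
- by apply: pathin3; rewrite // adj_sym.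
- by move=> u; rewrite 3!inE => /or3P[] /eqP->.
- by rewrite sz.
Qed.

(** A neighbour $t$ of $u$ outside $S$ serves as an additional entry into $D$,
at the price that the path through $u$ has to start at $u$. It saves one vertex
of $S$, so a linear forest with $q+1$ edges in which $u$ has degree at most $1$
is enough; it is found from a longest path starting at $u$, or away from $u$ if
$u$ is isolated in $D$. *)
Lemma rooted_hamiltonian u t : u \in D -> t \notin D -> t \notin S -> adj t u ->
  0 < #|S| -> #|D| = (q + #|S|).+1 ->
  (forall v, v \in D -> v != u -> #|N v| = q) -> #|N u| <= q ->
  hamiltonian G \/ (#|S| = 1 /\ N u = set0).
Proof.
move=> uD tD tS tu s0 cD deg degu; have c0 := card_S0 tS.
have Nsym v w : w \in N v -> v \in D -> v \in N w.
  by rewrite !mem_N => /andP[vw _] ->; rewrite adj_sym vw.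
case: (set_0Vmem (N u)) => [Nu0|[a0 a0N]].
  have [s1|s2] : #|S| = 1 \/ 1 < #|S| by clear -s0; lia.
    by right.
  left; pose X := D :\ u.
  have cX : #|X| = q + #|S| by have := cardsD1 u D; rewrite uD cD => -[].
  have degX v : v \in X -> q <= #|nbh_in X v|.
    rewrite !inE => /andP[nvu vD]; rewrite -(deg v) //.
    apply/subset_leq_card/subsetP=> w wN; have vNw := Nsym v w wN vD.
    move: wN; rewrite !inE => /andP[-> wD]; rewrite wD andbT /=.
    by apply/eqP=> wu; move: vNw; rewrite wu Nu0 inE.
  have toD p : pathin X p -> pathin D p /\ u \notin p.
    case/and3P=> up /allP aX sp; rewrite /pathin up sp andbT /=; split.
      by apply/allP=> v /aX; rewrite !inE => /andP[].
    by apply/negP=> /aX; rewrite !inE eqxx.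
  have le : q.+1 < #|X| by rewrite cX -(addn1 q) -addnS leq_add2l.
  have pu : pathin D [:: u] by rewrite /pathin /= uD.
  case: (linear_forest q0 le degX) => [[p /toD[pp np] sz]|[p [e [/toD[pp np] /toD[pe ne] ue szp sze]]]].
    apply: (@weave_one_end G D S n2 clC SD adjSD t u [::] [:: p]) => //.
    - by rewrite /= pu pp andbT; case: (p) sz.
    - by rewrite /= cats0 np (pathin_uniq pp).
    - by rewrite /= cats0 c0 cD; clear -sz; lia.
  apply: (@weave_one_end G D S n2 clC SD adjSD t u [::] [:: p; e]) => //.
  - by rewrite /= pu pp pe andbT; case: (p) szp => //; case: (e) sze.
  - by rewrite /= cats0 mem_cat negb_or np ne ue.
  - by rewrite /= cats0 size_cat c0 cD szp sze; clear; lia.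
left; have pu : pathin D [:: u] by rewrite /pathin /= uD.
pose P p := if p is x :: _ then (x == u) && pathin D p else false.
have [||p Pp maxP] := @longest_seq _ P [:: u]; first by rewrite /P eqxx.
  by case=> // x p /andP[_ /pathin_uniq].
case: p Pp maxP => // x p /andP[/eqP-> pp] maxP.
have maxp : max_from D u p.
  by split=> // p' pp'; apply: (maxP (u :: p')); rewrite /P eqxx.
have up := pathin_uniq pp.
have lD : last u p \in D by apply: (pathin_sub pp); apply: mem_last.
have [big|small] := ltnP q (size p).
  apply: (@weave_one_end G D S n2 clC SD adjSD t u p [::]) => //.
  - by rewrite /= pp.
  - by rewrite /= cats0.
  - rewrite /= cats0 c0 cD; clear -s0 big; lia.
have [ua0 a0D] : adj u a0 /\ a0 \in D by apply/andP; rewrite -mem_N.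
have p0 : 0 < size p := maxp.2 [:: a0] (pathin_edge uD a0D ua0).
have nlu : last u p != u.
  case: (p) p0 up => // b p' _ /andP[un _].
  by apply: contraNneq un => <-; rewrite /= mem_last.
have degl : #|nbh_in D (last u p)| = q by apply: deg.
have le_qp : q <= size p by rewrite -degl; apply: max_from_card.
have sz : size p = q by apply/eqP; rewrite eqn_leq small.
have [z zD zp] : exists2 z, z \in D & z \notin u :: p.
  by apply: exists_notin => //=; rewrite sz cD; clear -s0; lia.
have nzu : z != u by move: zp; rewrite inE negb_or => /andP[].
have [/exists_inP[w wN wp]|/exists_inPn none] :=
    boolP [exists (w | w \in N z), w \notin u :: p].
  move: wN; rewrite mem_N => /andP[zw wD]; have pzw := pathin_edge zD wD zw.
  apply: (@weave_one_end G D S n2 clC SD adjSD t u p [:: [:: z; w]]) => //.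
  - by rewrite /= pp pzw.
  - rewrite (_ : flatten _ = (u :: p) ++ [:: z; w]) //.
    apply: uniq_disjoint_cat up (pathin_uniq pzw) _ => v.
    by rewrite !inE => /orP[] /eqP->; rewrite -in_cons.
  - by rewrite c0 cD /= size_cat /= sz; clear; lia.
(* After a rotation any vertex of $p$ ends a longest path from $u$, so only $u$
   itself can have neighbours off the path. *)
have Nz w : w \in N z -> w = u.
  move=> wN; have := none w wN; rewrite negbK => /predU1P[//|wp].
  have /subsetP/(_ z) : nbh_in D w \subset u :: p.
    by apply: max_from_closed maxp _ wp; rewrite degl sz.
  by rewrite (negPf zp); case/(_ (Nsym _ _ wN zD))%type.
have q1 : q = 1.
  apply/eqP; rewrite eqn_leq q0 andbT leqNgt -(deg z zD nzu).
  by apply/negP=> /card_gt1P[a [b [/Nz-> /Nz->]]]; rewrite eqxx.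
have /card_gt0P[w wN] : 0 < #|N z| by rewrite (deg z zD nzu).
have zNu : z \in N u by rewrite -(Nz w wN); apply: Nsym.
case: p p0 pp zp {up lD sz maxp maxP small nlu degl le_qp none Nz} => // b p _ pp zp.
exfalso; move: degu; rewrite q1 leqNgt => /negP[]; apply/card_gt1P; exists z, b.
case/and3P: pp => _ /and3P[_ bD _] /andP[ub _].
split=> //; first by rewrite mem_N ub.
by move: zp; rewrite !inE !negb_or => /and3P[].
Qed.

(** Ore's bound will show that such neighbours belong to $v$ alone among the
vertices of $D$, hence entries into $D$ through different vertices do not
interfere. *)
Definition extra v : {set G} := nbh v :\: (D :|: S).

Hypothesis extra_inj : forall t v w,
  v \in D -> w \in D -> t \in extra v -> t \in extra w -> v = w.

Lemma extraP v t : v \in D -> t \in extra v -> [/\ t \notin D, t \notin S & adj t v].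
Proof.
by move=> vD; rewrite !inE negb_or => /andP[/andP[-> ->] ?]; rewrite adj_sym.
Qed.

(** A longest path starting at a vertex with an extra neighbour has at least
$q-1$ edges, and exactly that many only if its end has an extra neighbour as
well. The missing edges come from a second path off the first one, or are
replaced by a second entry into $D$. *)
Lemma two_entries_hamiltonian u w : 1 < q -> #|D| = (q + #|S|).+1 ->
  (forall v, v \in D -> #|N v| + #|extra v| = q) ->
  (forall v, v \in D -> #|extra v| <= 1) ->
  u \in D -> w \in D -> u != w -> extra u != set0 -> extra w != set0 ->
  hamiltonian G.
Proof.
move=> q2 cD deg ex1 uD wD nuw eu ew.
have Nsym v v' : v' \in N v -> v \in D -> v \in N v'.
  by rewrite !mem_N => /andP[vw _] ->; rewrite adj_sym vw.
have deg0 v : v \in D -> extra v = set0 -> #|N v| = q.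
  by move=> vD ev; rewrite -(deg v vD) ev cards0 addn0.
have degq v : v \in D -> q <= #|N v|.+1.
  by move=> vD; rewrite -(deg v vD) -addn1 leq_add2l ex1.
pose P p := if p is x :: _ then (extra x != set0) && pathin D p else false.
have [||p Pp maxP] := @longest_seq _ P [:: u]; first by rewrite /P eu /pathin /= uD.
  by case=> // x p /andP[_ /pathin_uniq].
case: p Pp maxP => // x p /andP[ex pp] maxP.
have maxE y p' : extra y != set0 -> pathin D (y :: p') -> size p' <= size p.
  by move=> ey pp'; apply: (maxP (y :: p')); rewrite /P ey.
have maxp : max_from D x p by split=> // p'; apply: maxE.
have up := pathin_uniq pp.
have lD : last x p \in D by apply: (pathin_sub pp); apply: mem_last.
have xD : x \in D by apply: (pathin_sub pp); apply: mem_head.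
have [t tE] := set0Pn _ ex; have [tD tS tx] := extraP xD tE.
have c0 := card_S0 tS; have lcard := max_from_card maxp.
have degl := degq _ lD; rewrite -/(N _) in lcard.
have fin_path e : pathin D e -> e != [::] -> (forall v, v \in e -> v \notin x :: p) ->
    q.+2 <= size p + size e -> hamiltonian G.
  move=> pe ne de sze.
  apply: (@weave_one_end G D S n2 clC SD adjSD t x p [:: e]) => //.
  - by rewrite /= pp pe ne.
  - by rewrite /= cats0; apply: (uniq_disjoint_cat up (pathin_uniq pe) de).
  - rewrite /= cats0 size_cat c0 cD; clear -sze; lia.
have fin_extra h e : pathin D (h :: e) -> (forall v, v \in h :: e -> v \notin x :: p) ->
    extra (last h e) != set0 -> q <= size p + size e -> hamiltonian G.
  move=> pe de /set0Pn[t' t'E] sze.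
  have lhD : last h e \in D by apply: (pathin_sub pe); apply: mem_last.
  have [t'D t'S t'l] := extraP lhD t'E.
  apply: (@weave_two_ends G D S n2 clC SD adjSD t x p [::] h e t') => //.
  - by rewrite inE negb_or tD.
  - by rewrite inE negb_or t'D.
  - apply/eqP=> tt; rewrite -tt in t'E.
    have := de _ (mem_last h e); rewrite -(extra_inj xD lhD tE t'E) mem_head.
    by [].
  - by rewrite adj_sym.
  - by rewrite /= pp pe.
  - by rewrite /= cats0; apply: (uniq_disjoint_cat up (pathin_uniq pe) de).
  - rewrite /= cats0 size_cat /= cD; clear -sze; lia.
have [big|small] := ltnP q (size p).
  apply: (@weave_one_end G D S n2 clC SD adjSD t x p [::]) => //.
  - by rewrite /= pp.
  - by rewrite /= cats0.
  - rewrite /= cats0 c0 cD; clear -big; lia.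
have p0 : 0 < size p by clear -degl lcard q2; lia.
have nlx : last x p != x.
  case: (p) p0 up => // b p' _ /andP[xn _].
  by apply: contraNneq xn => <-; rewrite /= mem_last.
move: small; rewrite leq_eqVlt => /orP[/eqP sz|small].
- case: (boolP (D \subset x :: p)) => [|/subsetPn[z zD zp]].
    move=> /subsetP covp.
    (* A path through all of $D$ that can be entered at both ends is enough. *)
    have close p' : pathin D (x :: p') -> perm_eq p' p ->
        extra (last x p') != set0 -> last x p' != x -> hamiltonian G.
      move=> pp' perm /set0Pn[t' t'E] nl.
      have l'D : last x p' \in D by apply: (pathin_sub pp'); apply: mem_last.
      have [t'D t'S t'l] := extraP l'D t'E.
      have ntt : t != t'.
        apply: contraNneq nl => tt; rewrite -tt in t'E.
        by apply/eqP/esym; apply: extra_inj tE t'E.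
      apply: (@clique_path_hamiltonian G (~: D) t (x :: rcons p' t')) => //.
      - by rewrite inE.
      - by rewrite /= last_rcons inE.
      - rewrite cons_uniq -rcons_cons mem_rcons inE negb_or ntt rcons_uniq.
        rewrite (pathin_uniq pp') andbT.
        apply/andP; split; first by apply: contra tD => /(pathin_sub pp').
        by apply: contra t'D => /(pathin_sub pp').
      - case/and3P: pp' => _ _ sp'.
        by rewrite /= tx rcons_path (sp' : path _ _ _) adj_sym.
      - move=> v; rewrite inE negbK => /covp; rewrite !inE mem_rcons inE (perm_mem perm).
        by case/orP=> ->; rewrite ?orbT.
    have [el|nel] := eqVneq (extra (last x p)) set0; last exact: close nel nlx.
    have full : size p <= #|nbh_in D (last x p)| by rewrite -/(N _) (deg0 _ lD el) sz.
    have [y [yD nyx ey]] : exists y, [/\ y \in D, y != x & extra y != set0].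
      have [ux|nux] := eqVneq u x; last by exists u.
      by exists w; split; rewrite // eq_sym -ux.
    have yp : y \in p by have := covp y yD; rewrite inE (negPf nyx).
    have [p' [maxp' perm lp']] := max_from_rotate maxp full yp.
    by apply: (close p'); rewrite ?lp' //; case: maxp'.
  have [ez|nez] := eqVneq (extra z) set0; last first.
    apply: (fin_extra z [::]) => //; rewrite ?addn0 ?sz //.
      by rewrite /pathin /= zD.
    by move=> v; rewrite inE => /eqP->.
  have [/exists_inP[v vN vp]|/exists_inPn none] :=
      boolP [exists (v | v \in N z), v \notin x :: p].
    move: vN; rewrite mem_N => /andP[zv vD].
    apply: (fin_path [:: z; v]) => //; first exact: pathin_edge.
      by move=> v'; rewrite !inE => /orP[] /eqP->; rewrite -in_cons.
    by rewrite sz addn2.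
  (* Again $z$ can be inserted, here just after the root. *)
  have NzE : N z = [set v in x :: p] :\ last x p.
    apply/eqP; rewrite eqEcard card_path_minus_last // (deg0 z zD ez) sz leqnn andbT.
    apply/subsetP=> v vN; rewrite !inE.
    have := none v vN; rewrite negbK inE => ->; rewrite andbT.
    apply: contraNneq zp => vl; have /subsetP := max_from_end maxp; apply.
    by rewrite -vl; apply: Nsym.
  have zx : adj x z.
    have : x \in N z by rewrite NzE !inE eqxx andbT eq_sym.
    by rewrite mem_N adj_sym => /andP[].
  case: p pp up sz maxE zp NzE {maxP maxp fin_path fin_extra lD nlx lcard degl none p0} => [|a [|b p]].
  - by move=> _ _ /= q_0; move: q2; rewrite -q_0.
  - by move=> _ _ /= q_1; move: q2; rewrite -q_1.
  move=> pp up sz maxE zp NzE; exfalso.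
  have za : adj z a.
    have : a \in N z.
      rewrite NzE !inE eqxx orbT andbT.
      by case/and3P: up => _ + _; apply: contraNneq => ->; rewrite /= mem_last.
    by rewrite mem_N => /andP[].
  suff /(maxE _ _ ex) : pathin D [:: x, z, a, b & p] by rewrite /= ltnn.
  case/and3P: (pp) => _ allp /andP[_ sp]; apply/and3P; split.
  - have -> : uniq [:: x, z, a, b & p] = uniq [:: z, x, a, b & p].
      exact: (perm_uniq (perm_mid z [:: x] [:: a, b & p])).
    by rewrite cons_uniq zp.
  - by move: allp => /= /andP[-> ->]; rewrite !andbT; apply: zD.
  - by rewrite /= zx za.
have NlE : #|N (last x p)| = size p.
  by apply/eqP; rewrite eqn_leq lcard -ltnS (leq_trans small degl).
have el : extra (last x p) != set0.
  by apply: contraTneq small => /(deg0 _ lD); rewrite NlE => ->; rewrite ltnn.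
(* The path has $q$ vertices and all of them can be made the end of a path that
   is longest among those starting at a vertex with an extra neighbour: for the
   root, reverse the path. *)
have clos y : y \in x :: p -> N y \subset x :: p.
  case/predU1P=> [->|]; last by apply: max_from_closed maxp _; rewrite -/(N _) NlE.
  have := pathin_rev pp; case def: (rev (x :: p)) => [|l p'] pl.
    by move/(congr1 size): def; rewrite size_rev.
  have ll : last x p = l by have := congr1 (head x) def; rewrite lastI rev_rcons.
  have szp' : size p' = size p by have := congr1 size def; rewrite size_rev /= => -[].
  have maxl : max_from D l p' by split=> // p2; rewrite szp'; apply: maxE; rewrite -ll.
  have := max_from_end maxl; have -> : last l p' = x by rewrite -(last_cons x) -def rev_cons last_rcons.
  move=> /subset_trans; apply; rewrite -def; apply/subsetP=> v; by rewrite mem_rev.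
have [z zD zp] : exists2 z, z \in D & z \notin x :: p.
  by apply: exists_notin => //=; rewrite cD; clear -small; lia.
have out v : v \in N z -> v \notin x :: p.
  by move=> vN; apply: contra zp => /clos /subsetP; apply; apply: Nsym.
have [ez|nez] := eqVneq (extra z) set0; last first.
  have /card_gt0P[v vN] : 0 < #|N z| by rewrite -ltnS (leq_trans q2 (degq z zD)).
  have vp := out v vN; move: vN; rewrite mem_N => /andP[zv vD].
  apply: (fin_extra v [:: z]) => //.
  - by apply: pathin_edge; rewrite // adj_sym.
  - by move=> v'; rewrite !inE => /orP[] /eqP->; rewrite -in_cons.
  - by rewrite addn1 -NlE.
have /card_gt1P[a [b [aN bN nab]]] : 1 < #|N z| by rewrite (deg0 z zD ez).
have ap := out a aN; have bp := out b bN.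
move: aN bN; rewrite !mem_N => /andP[za aD] /andP[zb bD].
apply: (fin_path [:: a; z; b]) => //.
- by apply: pathin3; rewrite // adj_sym.
- by move=> v; rewrite 3!inE => /or3P[] /eqP->.
- by rewrite addn3 !ltnS -NlE.
Qed.

(** The case $q=1$: $D$ induces a matching, and its unmatched vertices are those
with an extra neighbour. One edge of the matching and two entries suffice;
without any edge, two paths pair up four entries, and their ends in the clique
are adjacent. *)
Lemma isolated_entries_hamiltonian u w : #|D| = #|S|.+2 ->
  (forall v, v \in D -> #|N v| + #|extra v| = 1) ->
  u \in D -> w \in D -> u != w -> extra u != set0 -> extra w != set0 ->
  hamiltonian G \/ (#|D| <= 3 /\ forall v, v \in D -> N v = set0).
Proof.
move=> cD deg uD wD nuw eu ew.
have iso v : v \in D -> extra v != set0 -> N v = set0.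
  move=> vD; rewrite -card_gt0 => ev; apply/eqP; rewrite -cards_eq0.
  by have := deg v vD; clear -ev; lia.
have [/exists_inP[a aD /set0Pn[b]]|/exists_inPn none] :=
    boolP [exists (a | a \in D), N a != set0].
  rewrite mem_N => /andP[ab bD]; left.
  have [t tE] := set0Pn _ eu; have [tD tS tu] := extraP uD tE.
  have [t' t'E] := set0Pn _ ew; have [t'D t'S t'w] := extraP wD t'E.
  have pab := pathin_edge aD bD ab.
  have nN v : v \in D -> extra v != set0 -> v \notin [:: a; b].
    move=> vD /(iso v vD) Nv; rewrite !inE negb_or; apply/andP; split.
      by apply/eqP=> va; move: (in_N ab bD); rewrite -va Nv inE.
    by apply/eqP=> vb; move: (@in_N a b); rewrite -vb Nv inE adj_sym vb ab aD => /(_ isT isT).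
  apply: (@weave_two_ends G D S n2 clC SD adjSD t u [::] [:: [:: a; b]] w [::] t') => //.
  - by rewrite inE negb_or tD.
  - by rewrite inE negb_or t'D.
  - by apply: contraNneq nuw => tt; rewrite -tt in t'E; rewrite (extra_inj uD wD tE t'E).
  - by rewrite adj_sym.
  - by rewrite /= pab /pathin /= uD wD.
  - have := nN u uD eu; have := nN w wD ew; case/and3P: pab => /=.
    rewrite !inE !negb_or nuw => /andP[-> _] _ _ /andP[-> ->] /andP[-> ->].
    by [].
  - by rewrite /= cD; clear; lia.
have iso' v : v \in D -> N v = set0 by move=> vD; apply/eqP; rewrite -[_ == _]negbK none.
have [c3|c4] := leqP #|D| 3; first by right.
left; have /card_geqP[l [ul szl lD]] := c4.
case: l ul szl lD => [|v1 [|v2 [|v3 [|v4 []]]]] // ul _ lD.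
have inD v : v \in [:: v1; v2; v3; v4] -> v \in D by apply: lD.
have exv v : v \in D -> exists t, [/\ t \notin D, t \notin S, adj t v & t \in extra v].
  move=> vD; have : extra v != set0.
    by rewrite -card_gt0 -(deg v vD) (iso' v vD) cards0.
  by case/set0Pn=> t tE; exists t; have [] := extraP vD tE.
have v1D : v1 \in D by apply: inD; rewrite !inE eqxx.
have v2D : v2 \in D by apply: inD; rewrite !inE eqxx ?orbT.
have v3D : v3 \in D by apply: inD; rewrite !inE eqxx ?orbT.
have v4D : v4 \in D by apply: inD; rewrite !inE eqxx ?orbT.
have [t1 [t1D t1S t1v t1E]] := exv v1 v1D.
have [t2 [t2D t2S t2v t2E]] := exv v2 v2D.
have [t3 [t3D t3S t3v t3E]] := exv v3 v3D.
have [t4 [t4D t4S t4v t4E]] := exv v4 v4D.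
have /card_gt1P[s1 [s2 [s1S s2S ns]]] : 1 < #|S| by move: c4; rewrite cD.
have s1D := SnD s1S; have s2D := SnD s2S.
have ntt v v' t t' : v \in D -> v' \in D -> t \in extra v -> t' \in extra v' ->
    v != v' -> t != t'.
  move=> vD v'D tE t'E; apply: contraNneq => tt; rewrite -tt in t'E.
  by rewrite (extra_inj vD v'D tE t'E).
have t23 : adj t2 t3.
  move/cliqueP: clC; apply; rewrite ?inE //.
  apply: (ntt v2 v3) => //.
  by move: ul; rewrite /= !inE !negb_or => /and4P[_ /andP[]].
pose vs := [:: v1; v2; v3; v4]; pose ts := [:: t1; t2; t3; t4]; pose ss := [:: s1; s2].
have tsS t : t \in ts -> (t \notin S) && (t \notin D).
  by rewrite !inE => /or4P[] /eqP->; apply/andP.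
have ssS s : s \in ss -> (s \in S) && (s \notin D).
  by rewrite !inE => /orP[] /eqP->; apply/andP.
have perm : perm_eq (vs ++ ts ++ ss) (t1 :: [:: v1; s1; v2; t2; t3; v3] ++ [::] ++ [:: s2; v4; t4]).
  exact: perm_double_chain.
have uL : uniq (t1 :: [:: v1; s1; v2; t2; t3; v3] ++ [::] ++ [:: s2; v4; t4]).
  rewrite -(perm_uniq perm).
  have /and4P[/and3P[n12 n13 n14] /andP[n23 n24] n34 _] :
      [&& [&& v1 != v2, v1 != v3 & v1 != v4], (v2 != v3) && (v2 != v4), v3 != v4 & true].
    by move: ul; rewrite /= !inE !negb_or.
  apply: uniq_disjoint_cat ul _ _; last first.
    move=> t; rewrite mem_cat => h; apply/negP=> /lD tD.
    by case/orP: h => [/tsS|/ssS] /andP[_]; rewrite tD.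
  apply: uniq_disjoint_cat; last first.
  - by move=> s /ssS/andP[sS _]; apply/negP=> /tsS; rewrite sS.
  - by rewrite /= inE ns.
  rewrite /= !inE !negb_or.
  rewrite (ntt v1 v2 t1 t2) // (ntt v1 v3 t1 t3) // (ntt v1 v4 t1 t4) //.
  by rewrite (ntt v2 v3 t2 t3) // (ntt v2 v4 t2 t4) // (ntt v3 v4 t3 t4).
apply: (@weave G D S n2 clC SD adjSD t1 [:: v1; s1; v2; t2; t3; v3] [::] s2 [:: v4; t4]) => //.
- by rewrite /= t1v adj_sym adjSD // adjSD // adj_sym t2v t23 t3v.
- by rewrite /= adjSD // adj_sym t4v.
rewrite !card_setD_seq // -!(permP perm) !count_cat (count_all_in lD).
rewrite (@count_all_out _ D ts) ?(@count_all_out _ D ss) ?(@count_all_out _ S vs).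
- rewrite (@count_all_out _ S ts) ?(@count_all_in _ S ss) /= ?cD //.
  + by clear; lia.
  + by move=> s /ssS/andP[].
  + by move=> t /tsS/andP[].
- by move=> v /lD; apply: contraL => /SnD.
- by move=> s /ssS/andP[].
- by move=> t /tsS/andP[].
Qed.

End Cases.

(** * The extremal graphs *)

Lemma subgraph_of_refl (G : sgraph) : subgraph_of G G.
Proof. by exists id. Qed.

Lemma embed_H (G : sgraph) n d (B S : {set G}) :
  nverts G = n -> #|B| = d -> #|S| = d -> S \subset ~: B ->
  (forall b, b \in B -> nbh b \subset S) ->
  exists H, is_H n d H /\ subgraph_of G H.
Proof.
move=> Gn cB cS /subsetP SB nb.
have SnB a : a \in S -> a \notin B by move/SB; rewrite inE.
have BnS b : b \in B -> (b \in S) = false by move=> bB; apply: contraTF bB => /SnB.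
pose e x y := (x != y) && [|| (x \notin B) && (y \notin B),
                 (x \in B) && (y \in S) | (y \in B) && (x \in S)].
have sy : symmetric e.
  by move=> x y; rewrite /e eq_sym andbC [(y \notin B) && _]andbC
    [((y \in B) && _) || _]orbC andbC.
have ir : irreflexive e by move=> x; rewrite /e eqxx.
have eBB x y : x \in B -> y \in B -> e x y = false.
  by move=> xB yB; rewrite /e xB yB !BnS //= andbF.
have eBS b y : b \in B -> e b y = (y \in S).
  move=> bB; rewrite /e bB (BnS b bB) andbF orbF /=; have [yS|yS] := boolP (y \in S).
    by rewrite andbT; apply: contraNneq (SnB y yS) => <-.
  by rewrite andbF.
exists (SGraph sy ir); split.
  exists (~: B : {set SGraph sy ir}), (S : {set SGraph sy ir}); rewrite setCK.
  split=> //.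
  - apply/cliqueP=> x y; rewrite !inE => xB yB nxy.
    by rewrite /= /e nxy xB yB.
  - apply/forall_inP=> x xB; apply/forall_inP=> y yB.
    by apply/negbT/eBB.
  - split=> //; first by apply/subsetP.
    by move=> b; rewrite inE negbK => bB; apply/setP=> y; rewrite inE; apply: eBS.
exists id => // x y xy; rewrite /= /e.
have nxy : x != y by apply: contraTneq xy => ->; rewrite adj_irr.
rewrite nxy /=; have [xB|xB] := boolP (x \in B).
  by have /subsetP/(_ y) := nb x xB; rewrite inE xy => /(_ isT) ->; rewrite orbT.
have [yB|yB //] := boolP (y \in B).
by have /subsetP/(_ x) := nb y yB; rewrite inE adj_sym xy => /(_ isT) ->.
Qed.

Lemma embed_K' (G : sgraph) n d (B : {set G}) v :
  nverts G = n -> #|B| = d -> v \notin B ->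
  (forall b, b \in B -> nbh b \subset v |: B) ->
  exists H, is_K' n d H /\ subgraph_of G H.
Proof.
move=> Gn cB vB nb.
pose e x y := (x != y) && ((x \in ~: B) && (y \in ~: B) || (x \in v |: B) && (y \in v |: B)).
have sy : symmetric e.
  by move=> x y; rewrite /e eq_sym [(y \in ~: B) && _]andbC [(y \in v |: B) && _]andbC.
have ir : irreflexive e by move=> x; rewrite /e eqxx.
exists (SGraph sy ir); split.
  exists (~: B : {set SGraph sy ir}), (v |: B : {set SGraph sy ir}), v.
  split=> //.
  - by rewrite cardsU1 vB cB.
  - by apply/setP=> x; rewrite !inE; case: (x \in B); rewrite ?orbT.
  - apply/setP=> x; rewrite !inE; case: eqVneq => [->|_] /=; first by rewrite vB.
    by rewrite andNb.
exists id => // x y xy; rewrite /= /e.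
have nxy : x != y by apply: contraTneq xy => ->; rewrite adj_irr.
have sub a b : a \in B -> adj a b -> b \in v |: B.
  by move=> /nb/subsetP sub ab; apply: sub; rewrite inE.
rewrite nxy /=; have [xB|xB] := boolP (x \in B).
  by rewrite (sub x y) // setU1r ?orbT.
have [yB|yB] := boolP (y \in B); last by rewrite !inE xB yB.
by rewrite (sub y x) ?(setU1r _ yB) ?orbT // adj_sym.
Qed.

Lemma edges_inP (G : sgraph) (D E : {set G}) :
  reflect (exists a b, [/\ a \in D, b \in D, adj a b & E = [set a; b]]) (E \in edges_in D).
Proof.
apply: (iffP idP) => [|[a [b [aD bD ab ->]]]].
  rewrite !inE => /andP[/andP[/cards2P[a [b [nab ->]]] /cliqueP cE] /subsetP sub].
  by exists a, b; split; rewrite ?sub ?cE // !inE eqxx ?orbT.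
have nab : a != b by apply: contraTneq ab => ->; rewrite adj_irr.
rewrite !inE cards2 nab eqxx /=; apply/andP; split.
  by apply/cliqueP=> x y; rewrite !inE => /orP[] /eqP-> /orP[] /eqP->;
    rewrite ?eqxx // => _; rewrite // adj_sym.
by apply/subsetP=> x; rewrite !inE => /orP[] /eqP->.
Qed.

(** * Classification of the edge-maximal graphs *)

Section Classification.
Variables (G : sgraph) (n d : nat) (D : {set G}).
Hypotheses (satG : saturated G) (Gn : nverts G = n) (n2 : 2 < nverts G) (d0 : 0 < d).
Hypothesis degmin : forall v : G, d <= #|nbh v|.
Hypothesis clC : clique (~: D).

Let N := nbh_in D.
Let S : {set G} := [set a | (a \notin D) && (D \subset nbh a)].

Let SD : {subset S <= ~: D}.
Proof. by move=> a; rewrite !inE => /andP[]. Qed.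

Let adjSD a v : a \in S -> v \in D -> adj a v.
Proof. by rewrite inE => /andP[_ /subsetP sub] /sub; rewrite inE. Qed.

Let nonham : ~ hamiltonian G. Proof. by case: satG. Qed.

Let mem_N u v : (u \in N v) = adj v u && (u \in D).
Proof. by rewrite !inE. Qed.

(** Since a vertex $a$ outside $D$ is adjacent to the whole clique, Ore's bound
limits its neighbours in $D$ as soon as it misses some $v \in D$. *)
Lemma missing_bound a v : a \notin D -> v \in D -> ~~ adj a v ->
  #|nbh v| + #|N a| <= #|D|.
Proof.
move=> aD vD nav.
have nva : v != a by apply: contraNneq aD => <-.
have lt : #|nbh v| + #|nbh a| < nverts G.
  by apply: saturated_degree_sum; rewrite // adj_sym.
have cC : #|~: D| = #|(~: D) :\ a|.+1.
  by have := cardsD1 a (~: D); rewrite inE aD.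
have sub : N a :|: (~: D) :\ a \subset nbh a.
  apply/subsetP=> w; rewrite !inE => /orP[/andP[]//|/andP[nwa wD]].
  by move/cliqueP: clC; apply; rewrite ?inE // eq_sym.
have dis : #|N a :|: (~: D) :\ a| = #|N a| + #|(~: D) :\ a|.
  rewrite cardsU (_ : _ :&: _ = set0) ?cards0 ?subn0 //.
  by apply/setP=> w; rewrite !inE; case: (w \in D); rewrite ?andbF.
have := subset_leq_card sub; have := cardsCG D; move: lt; rewrite dis cC.
by clear; lia.
Qed.

Lemma extra_misses u t : u \in D -> t \in extra D S u ->
  exists w, [/\ w \in D, ~~ adj t w & t \notin D].
Proof.
rewrite !inE negb_or => uD /andP[/andP[tD]]; rewrite tD /= => /subsetPn[w wD].
by rewrite inE => ntw _; exists w.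
Qed.

Lemma nbh_split v : v \in D -> nbh v = N v :|: (S :|: extra D S v).
Proof.
move=> vD; apply/setP=> w; rewrite 2!in_setU mem_N [w \in extra _ _ _]inE in_setU inE.
have [wS|wS] := boolP (w \in S); first by rewrite adj_sym adjSD ?orbT.
by case: (w \in D); rewrite ?andbT ?andbF ?orbF.
Qed.

Lemma card_nbh_split v : v \in D -> #|nbh v| = #|N v| + #|S| + #|extra D S v|.
Proof.
move=> vD; rewrite {1}nbh_split // -addnA cardsU (_ : _ :&: _ = set0).
  rewrite cards0 subn0 cardsU (_ : S :&: _ = set0) ?cards0 ?subn0 //.
  by apply/setP=> w; rewrite in_setI in_setD in_setU in_set0; case: (w \in S); rewrite ?orbT.
apply/setP=> w; rewrite in_setI in_setU in_setD in_setU mem_N in_set0.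
have [wD|] := boolP (w \in D); last by rewrite andbF.
by rewrite orbF; apply/negbTE/negP=> /andP[_ /SD]; rewrite inE wD.
Qed.

Definition classified := (exists H, in_Hfamily n d H /\ subgraph_of G H) \/
  (d = 2 /\ is_G'2 n G) \/ (d = 3 /\ is_F3 n G).

Lemma in_H m : m = d \/ m = d.+1 -> (exists H, is_H n m H /\ subgraph_of G H) -> classified.
Proof.
by case=> -> [H [hH sub]]; left; exists H; split=> //; left; [constructor 1|constructor 2].
Qed.

Lemma in_K' m : m = d \/ m = d.+1 -> (exists H, is_K' n m H /\ subgraph_of G H) -> classified.
Proof.
by case=> -> [H [hH sub]]; left; exists H; split=> //; left; [constructor 3|constructor 4].
Qed.

(** If at most one vertex links $D$ to the rest, filling $D$ up to a clique gives
$K'$. *)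
Lemma small_S_K' m : m = d \/ m = d.+1 -> #|D| = m -> m < n -> #|S| <= 1 ->
  (forall v, v \in D -> extra D S v = set0) -> classified.
Proof.
move=> md cD lt s1 ex0; apply: (in_K' md).
have [v vD vS] : exists2 v, v \notin D & S \subset [set v].
  case: (set_0Vmem S) => [->|[v vS]].
    have /card_gt0P[v] : 0 < #|~: D|.
      by have := cardsCG D; rewrite cD Gn; clear -lt; lia.
    by rewrite inE; exists v => //; apply: sub0set.
  exists v; first by have := SD vS; rewrite inE.
  have /eqP -> // : [set v] == S by rewrite eqEcard sub1set vS cards1.
apply: (embed_K' (v := v)) Gn cD vD _ => b bD.
rewrite nbh_split // ex0 // setU0 setUC; apply: setUSS => //.
by apply/subsetP=> w; rewrite mem_N => /andP[].
Qed.

Lemma low_degree_d_classified : #|D| = d -> d < n -> (forall v, v \in D -> #|nbh v| <= d) -> classified.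
Proof.
move=> cD dn degD.
have deg v : v \in D -> #|nbh v| = d by move=> vD; apply/eqP; rewrite eqn_leq degD ?degmin.
have ex0 v : v \in D -> extra D S v = set0.
  move=> vD; apply/eqP/negPn/negP=> /set0Pn[t tE].
  have [w [wD ntw tD]] := extra_misses vD tE.
  have := missing_bound tD wD ntw; rewrite deg // cD -{2}[d]addn0 leq_add2l leqn0 cards_eq0.
  move/eqP=> Nt; have: v \in N t.
    by rewrite mem_N vD andbT adj_sym; move: tE; rewrite !inE => /andP[].
  by rewrite Nt inE.
have degN v : v \in D -> #|N v| + #|S| = d.
  by move=> vD; rewrite -[RHS](deg v vD) card_nbh_split // ex0 // cards0 addn0.
have [s1|s2] := leqP #|S| 1; first by apply: (small_S_K' (m := d)) => //; left.
have /card_gt0P[v0 v0D] : 0 < #|D| by rewrite cD.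
have := leq_addl #|N v0| #|S|; rewrite degN // leq_eqVlt => /orP[/eqP sd|sd].
  apply: (in_H (m := d)); first by left.
  apply: (embed_H Gn cD sd); first by apply/subsetP.
  move=> b bD; rewrite nbh_split // ex0 // setU0.
  have /eqP : #|N b| = 0 by have := degN b bD; rewrite sd; clear; lia.
  by rewrite cards_eq0 => /eqP->; rewrite set0U.
case: nonham; apply: (@regular_hamiltonian G D S (d - #|S|)) => //.
- by rewrite subn_gt0.
- by rewrite cD subnK // ltnW.
- by move=> v vD; rewrite -[X in X - _](degN v vD) addnK.
Qed.

Hypothesis cD : #|D| = d.+1.
Hypothesis dn : d.+1 < n.
Hypothesis degD : forall v, v \in D -> #|nbh v| <= d.+1.

(** By Ore's bound, a vertex outside $D \cup S$ that is adjacent to $u \in D$ is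
adjacent to no other vertex of $D$ and forces their degrees down to $d$. *)
Lemma extra_alone u t v : u \in D -> t \in extra D S u -> v \in D -> v != u ->
  ~~ adj t v /\ #|nbh v| = d.
Proof.
move=> uD tE; have [w [wD ntw tD]] := extra_misses uD tE => vD nvu.
have uN : u \in N t.
  by rewrite mem_N uD andbT adj_sym; move: tE; rewrite !inE => /andP[].
have N1 : #|N t| <= 1.
  by have := missing_bound tD wD ntw; rewrite cD; have := degmin w; clear; lia.
have ntv : ~~ adj t v.
  apply: contraL N1 => tv; rewrite -ltnNge; apply/card_gt1P; exists v, u.
  by rewrite mem_N tv.
split=> //; apply/eqP; rewrite eqn_leq degmin andbT.
have := missing_bound tD vD ntv; rewrite cD.
have : 0 < #|N t| by apply/card_gt0P; exists u.
by clear; lia.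
Qed.

Lemma extra_unique t v w : v \in D -> w \in D -> t \in extra D S v -> t \in extra D S w -> v = w.
Proof.
move=> vD wD tv tw; apply/eqP/negPn/negP=> nvw.
have [] := extra_alone wD tw vD nvw.
by rewrite adj_sym; move: tv; rewrite !inE => /andP[_ ->].
Qed.

(** Then $u$ may be counted with the clique: the other $d$ vertices of $D$ are
isolated in $D$ and only see $S$. *)
Lemma move_into_clique_H u : u \in D -> #|S| = d ->
  (forall v, v \in D -> v != u -> N v = set0 /\ extra D S v = set0) -> classified.
Proof.
move=> uD sd iso; apply: (in_H (m := d)); first by left.
apply: (@embed_H G n d (D :\ u) S) => //.
- by have := cardsD1 u D; rewrite uD cD => -[].
- by apply/subsetP=> a /SD; rewrite !inE negb_and => ->; rewrite orbT.
move=> b; rewrite !inE => /andP[nbu bD]; have [Nb eb] := iso b bD nbu.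
by rewrite nbh_split // Nb eb set0U setU0.
Qed.

(** Here the graph is given by $S$ and the graph on $D$. Two edges in $D$ are
disjoint when $q=0$, and allow a hamiltonian cycle. *)
Lemma no_extra_classified : (forall v, v \in D -> extra D S v = set0) -> classified.
Proof.
move=> ex0.
have degN v : v \in D -> d <= #|N v| + #|S| <= d.+1.
  move=> vD; have := degD vD; have := degmin v.
  by rewrite card_nbh_split // ex0 // cards0 addn0 => -> ->.
have nbhN v : v \in D -> nbh v = N v :|: S.
  by move=> vD; rewrite nbh_split // ex0 // setU0.
have [s1|s2] := leqP #|S| 1; first by apply: (small_S_K' (m := d.+1)) => //; right.
have /card_gt0P[v0 v0D] : 0 < #|D| by rewrite cD.
have SnD : S \subset ~: D by apply/subsetP.
have [sd|sd] := ltnP #|S| d.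
  case: (@nearly_regular_hamiltonian G D S (d - #|S|)) => //.
  - by rewrite subn_gt0.
  - by rewrite cD subnK // ltnW.
  - by move=> v /degN; rewrite /N; clear -sd; lia.
  case=> q1 s_2; rewrite -/N => N1; have d3 : d = 3 by move: q1; rewrite s_2; clear; lia.
  right; right; split=> //.
  have only a b c : a \in D -> b \in N a -> c \in N a -> b = c.
    by move=> /N1/eqP/cards1P[x ->]; rewrite !inE => /eqP-> /eqP->.
  have Nsym v w : v \in D -> w \in N v -> v \in N w.
    by rewrite !mem_N => -> /andP[vw _]; rewrite adj_sym vw.
  have inD v w : w \in N v -> w \in D by rewrite mem_N => /andP[].
  have nN v w : w \in N v -> v != w.
    by apply: contraTneq => ->; rewrite mem_N adj_irr.
  have part v : v \in D -> exists w, w \in N v.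
    by move=> /N1 Nv; apply/card_gt0P; rewrite Nv.
  have [v1 v10] := part v0 v0D; have v1D := inD _ _ v10.
  have u01 : uniq [:: v0; v1] by rewrite /= inE nN.
  have [|v2 v2D] := exists_notin (X := D) u01; first by rewrite cD d3.
  rewrite !inE negb_or => /andP[v20 v21].
  have [v3 v32] := part v2 v2D; have v3D := inD _ _ v32.
  have v30 : v0 != v3.
    apply: contraNneq v21 => v03; apply/eqP; apply: (only v0) => //.
    by rewrite v03; apply: Nsym.
  have v31 : v1 != v3.
    apply: contraNneq v20 => v13; apply/eqP; apply: (only v1) => //.
      by rewrite v13; apply: Nsym.
    exact: Nsym.
  have uall : uniq [:: v0; v1; v2; v3].
    by rewrite /= !inE !negb_or (nN v0 v1) // (nN v2 v3) // ![_ == v2]eq_sym v20 v21 v30 v31.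
  have DE : D = [set v0; v1; v2; v3].
    apply/esym/eqP; rewrite eqEcard; apply/andP; split.
      by apply/subsetP=> v; rewrite !inE -!orbA => /or4P[] /eqP->.
    rewrite cD d3; apply/card_geqP; exists [:: v0; v1; v2; v3]; split=> //.
    by move=> v; rewrite !inE -!orbA.
  exists (~: D), S, v0, v1, v2, v3; rewrite setCK; split.
    split=> //; apply/setP=> E; apply/edges_inP/set2P.
      case=> a [b [aD bD ab ->]].
      have bN : b \in N a by rewrite mem_N ab.
      have := aD; rewrite DE !inE -!orbA => /or4P[] /eqP ea; subst a.
      - by left; rewrite (only _ _ _ aD bN v10).
      - by left; rewrite (only _ _ _ aD bN (Nsym _ _ v0D v10)) setUC.
      - by right; rewrite (only _ _ _ aD bN v32).
      - by right; rewrite (only _ _ _ aD bN (Nsym _ _ v2D v32)) setUC.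
    case=> ->; [exists v0, v1|exists v2, v3]; split=> //.
      by move: v10; rewrite mem_N => /andP[].
    by move: v32; rewrite mem_N => /andP[].
  split=> // b bD; rewrite nbhN //.
  apply/setP=> w; rewrite in_setI in_setU in_setC mem_N.
  have [wS|wS] := boolP (w \in S); first by have := SD wS; rewrite inE orbT => ->.
  by case: (w \in D); rewrite ?andbF.
have [sd1|sd1] : #|S| = d.+1 \/ #|S| = d.
  by have := degN v0 v0D; clear -sd; lia.
  apply: (in_H (m := d.+1)); first by right.
  apply: (embed_H Gn cD sd1) => // b bD; rewrite nbhN //.
  have /eqP : #|N b| = 0 by have := degN b bD; rewrite sd1; clear; lia.
  by rewrite cards_eq0 => /eqP->; rewrite set0U.
have N1 v : v \in D -> #|N v| <= 1.
  by move=> /degN; rewrite sd1; clear; lia.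
have [/exists_inP[a aD /set0Pn[b bN]]|/exists_inPn none] :=
    boolP [exists (a | a \in D), N a != set0]; last first.
  apply: (move_into_clique_H v0D sd1) => v vD _; split; last exact: ex0.
  by apply/eqP; rewrite -[_ == _]negbK none.
have only v w w' : v \in D -> w \in N v -> w' \in N v -> w = w'.
  move=> vD wN w'N; apply/eqP/negPn/negP=> nww; have := N1 v vD.
  by rewrite leqNgt => /negP[]; apply/card_gt1P; exists w, w'.
move: (bN); rewrite mem_N => /andP[ab bD].
have aN : a \in N b by rewrite mem_N adj_sym ab.
left; exists G; split; last exact: subgraph_of_refl.
right; exists (~: D), S; rewrite setCK; split=> //.
  suff -> : edges_in D = [set [set a; b]] by rewrite cards1.
  apply/setP=> E; apply/edges_inP/set1P => [|->]; last by exists a, b.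
  case=> x [y [xD yD xy ->]].
  have yN : y \in N x by rewrite mem_N xy.
  have xN : x \in N y by rewrite mem_N adj_sym xy.
  have [xa|nxa] := eqVneq x a; first by rewrite xa (only a y b) // -xa.
  have [xb|nxb] := eqVneq x b; first by rewrite xb (only b y a) 1?setUC // -xb.
  have nya : y != a.
    by apply: contraNneq nxb => ya; apply/eqP; apply: (only a) => //; rewrite -ya.
  have nyb : y != b.
    by apply: contraNneq nxa => yb; apply/eqP; apply: (only b) => //; rewrite -yb.
  have /card_gt0P[s0 s0S] : 0 < #|S| by apply: ltnW.
  have pab := pathin_edge aD bD ab; have pxy := pathin_edge xD yD xy.
  case: nonham; apply: (@weave_one_end G D S n2 clC SD adjSD s0 a [:: b] [:: [:: x; y]]) => //.
  - by have := SD s0S; rewrite inE.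
  - exact: adjSD.
  - by rewrite /= pab pxy.
  - apply: (@uniq_disjoint_cat _ [:: a; b] [:: x; y]); [exact: pathin_uniq pab|exact: pathin_uniq pxy|].
    by move=> u; rewrite !inE => /orP[] /eqP->; rewrite negb_or ?nxa ?nxb ?nya.
  - have := cardsD1 s0 S; rewrite s0S sd1 cD /=; clear; lia.
split=> // v vD; rewrite nbhN //.
apply/setP=> w; rewrite in_setD in_setU mem_N.
have [wS|wS] := boolP (w \in S); first by have := SD wS; rewrite inE orbT => ->.
by case: (w \in D); rewrite ?andbF.
Qed.

(** A vertex $u$ that is the only one with extra neighbours is best counted with
the clique, which leaves the $d$ other vertices of $D$ for $H_{n,d}$ or
$K'_{n,d}$. *)
Lemma one_extra_classified u : u \in D -> extra D S u != set0 ->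
  (forall v, v \in D -> v != u -> extra D S v = set0) -> classified.
Proof.
move=> uD /set0Pn[t tE] ex0; have [tD tS tu] := extraP uD tE.
have cDu : #|D :\ u| = d by have := cardsD1 u D; rewrite uD cD => -[].
have degN v : v \in D -> v != u -> #|N v| + #|S| = d.
  move=> vD nvu; have [_ <-] := extra_alone uD tE vD nvu.
  by rewrite card_nbh_split // ex0 // cards0 addn0.
have nbhN v : v \in D -> v != u -> nbh v = N v :|: S.
  by move=> vD nvu; rewrite nbh_split // ex0 // setU0.
have NsubD v : N v \subset D by apply/subsetP=> w; rewrite mem_N => /andP[].
have [v0] : exists v0, v0 \in D :\ u by apply/card_gt0P; rewrite cDu.
rewrite !inE => /andP[nv0u v0D].
have uDu : u \notin D :\ u by rewrite !inE eqxx.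
have [s0|s0] := posnP #|S|.
  apply: (in_K' (m := d)); first by left.
  apply: (embed_K' Gn cDu uDu) => b; rewrite in_setD1 => /andP[nbu bD].
  have S0 : S = set0 by apply/eqP; rewrite -cards_eq0 s0.
  by rewrite nbhN // S0 setU0 setD1K.
have := leq_addl #|N v0| #|S|; rewrite degN // leq_eqVlt => /orP[/eqP sd|sd].
  apply: (move_into_clique_H uD sd) => v vD nvu; split; last exact: ex0.
  have /eqP : #|N v| = 0 by have := degN v vD nvu; rewrite sd; clear; lia.
  by rewrite cards_eq0 => /eqP.
case: (@rooted_hamiltonian G D S (d - #|S|) n2 clC SD adjSD _ u t) => //.
- by rewrite subn_gt0.
- by rewrite cD subnK // ltnW.
- by move=> v vD nvu; rewrite -/N -[X in X - _](degN v vD nvu) addnK.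
- have := degD uD; rewrite card_nbh_split //.
  have : 0 < #|extra D S u| by apply/card_gt0P; exists t.
  by rewrite /N; clear; lia.
rewrite -/N => -[/eqP/cards1P[x Sx] Nu0].
have xS : x \in S by rewrite Sx inE.
have xD : x \notin D by have := SD xS; rewrite inE.
apply: (in_K' (m := d)); first by left.
have xDu : x \notin D :\ u by rewrite !inE (negPf xD) andbF.
apply: (embed_K' Gn cDu xDu) => b; rewrite in_setD1 => /andP[nbu bD].
rewrite nbhN // Sx setUC setUS //; apply/subsetP=> w wN; rewrite in_setD1.
rewrite (subsetP (NsubD b) _ wN) andbT; apply: contraTneq wN => ->.
apply/negP; rewrite mem_N => /andP[bu _].
by have : b \in N u; [rewrite mem_N adj_sym bu|rewrite Nu0 inE].
Qed.

(** Let $t$ be an extra neighbour of $u$ and take a hamiltonian path from $v$ to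
$t$. The predecessor of an extra neighbour of $v$ on this path is not adjacent
to $t$, as there would be a crossing, so it lies in $D$ and must be $v$ itself:
the extra neighbour is the second vertex of the path. *)
Lemma extra_le1 u v : u \in D -> v \in D -> u != v -> extra D S u != set0 ->
  #|extra D S v| <= 1.
Proof.
move=> uD vD nuv /set0Pn[t tE]; rewrite leqNgt; apply/negP.
case/card_gt1P=> t1 [t2 [t1E t2E n12]].
have [tD tS tu] := extraP uD tE.
have [ntv _] : ~~ adj t v /\ #|nbh v| = d.
  by apply: extra_alone uD tE vD _; rewrite eq_sym.
have nvt : v != t by apply: contraNneq tD => <-.
case: (satG) => _ /(_ v t nvt); rewrite adj_sym => /(_ ntv) [s hp ls].
have [us ps alls] := hp.
have follows t' : t' \in extra D S v -> exists q, s = t' :: q.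
  move=> t'E; have [t'D t'S t'v] := extraP vD t'E.
  have nt'v : t' != v by apply: contraNneq t'D => ->.
  have [p [q]] := path_pred us (alls t') nt'v.
  set a := nth _ _ _ => def.
  have nat : ~~ adj a t.
    by rewrite -ls; apply: hamiltonian_path_no_crossing def _; rewrite // adj_sym.
  have at' : adj a t'.
    have : sorted (@adj G) (v :: s) by [].
    by rewrite def cat_rcons sorted_cat_cons /= => /andP[_ /andP[]].
  have aD : a \in D.
    apply: contraR nat => aD; move/cliqueP: clC; apply; rewrite ?inE //.
    have := us; rewrite def cat_uniq => /and3P[_ /hasPn/(_ t) + _].
    have -> : t \in t' :: q by rewrite -ls -(last_cons v v) def last_cat /= mem_last.
    by move=> /(_ isT); apply: contraNneq => <-; rewrite mem_rcons mem_head.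
  have av : a = v.
    apply/eqP/negPn/negP=> nav; have [] := extra_alone vD t'E aD nav.
    by rewrite adj_sym at'.
  move: def us; rewrite av; case: p => [[->] _|b p [_ ->]]; first by exists q.
  by rewrite cons_uniq mem_cat mem_rcons mem_head.
have [q1 s1] := follows t1 t1E; have [q2 s2] := follows t2 t2E.
by move: n12; move: s2; rewrite s1 => -[-> _]; rewrite eqxx.
Qed.

(** Now all vertices of $D$ have degree $d$. For $q=1$ and $d\le 2$ there are too
few vertices in $D$ to pair up the entries: these are the cases of $H_{n,1}$ and
$G'_{n,2}$. *)
Lemma two_extra_classified u w : u \in D -> w \in D -> u != w ->
  extra D S u != set0 -> extra D S w != set0 -> classified.
Proof.
move=> uD wD nuw eu ew.
have degv v : v \in D -> #|N v| + #|S| + #|extra D S v| = d.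
  move=> vD; rewrite -card_nbh_split //; have [vu|nvu] := eqVneq v u.
    by have [t tE] := set0Pn _ ew; have [] := extra_alone wD tE vD; rewrite // vu.
  by have [t tE] := set0Pn _ eu; have [] := extra_alone uD tE vD nvu.
have ex1 v : v \in D -> #|extra D S v| <= 1.
  move=> vD; have [vu|nvu] := eqVneq v u.
    by apply: (extra_le1 wD vD _ ew); rewrite vu eq_sym.
  by apply: (extra_le1 uD vD _ eu); rewrite eq_sym.
have sd : #|S| < d.
  have := degv u uD; have : 0 < #|extra D S u| by rewrite card_gt0.
  by clear; lia.
have [q1|q2] : d = #|S|.+1 \/ #|S|.+1 < d by clear -sd; lia.
  have degN v : v \in D -> #|N v| + #|extra D S v| = 1.
    by move=> /degv; rewrite q1; clear; lia.
  case: (@isolated_entries_hamiltonian G D S n2 clC SD adjSD extra_unique u w) => //.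
    by rewrite cD q1.
  case=> D3; rewrite -/N => N0.
  have [d1|d2] : d = 1 \/ d = 2 by move: D3 d0; rewrite cD; clear; lia.
    apply: (in_H (m := d)); first by left.
    apply: (@embed_H G n d [set u] (nbh u)) => //.
    - by rewrite cards1.
    - by rewrite card_nbh_split // degv.
    - by apply/subsetP=> v; rewrite !inE; apply: contraTneq => ->; rewrite adj_irr.
    - by move=> b; rewrite inE => /eqP->.
  have /eqP/cards1P[x Sx] : #|S| = 1 by move: q1; rewrite d2 => -[].
  have xS : x \in S by rewrite Sx inE.
  have xD : x \notin D by have := SD xS; rewrite inE.
  have [l [ul szl lD]] : exists l, [/\ uniq l, size l = 3 & {subset l <= D}].
    by apply/card_geqP; rewrite cD d2.
  case: l ul szl lD => [|b1 [|b2 [|b3 []]]] // ul _ lD.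
  have b1D : b1 \in D by apply: lD; rewrite !inE eqxx.
  have b2D : b2 \in D by apply: lD; rewrite !inE eqxx ?orbT.
  have b3D : b3 \in D by apply: lD; rewrite !inE eqxx ?orbT.
  have exE v : v \in D -> exists a, extra D S v = [set a].
    by move=> vD; apply/cards1P; rewrite -(degN v vD) N0 // cards0.
  have [a1 E1] := exE b1 b1D; have [a2 E2] := exE b2 b2D; have [a3 E3] := exE b3 b3D.
  have nbhE v a : v \in D -> extra D S v = [set a] -> nbh v = [set a; x].
    by move=> vD E; rewrite nbh_split // N0 // set0U E Sx setUC.
  have aS v a : v \in D -> extra D S v = [set a] -> (a \notin D) && (a != x).
    move=> vD E; have aE : a \in extra D S v by rewrite E inE.
    have [aD anS _] := extraP vD aE; rewrite aD; apply: contraNneq anS => ->.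
    exact: xS.
  have naa v v' a a' : v \in D -> v' \in D -> extra D S v = [set a] ->
      extra D S v' = [set a'] -> v != v' -> a != a'.
    move=> vD v'D E E'; apply: contraNneq => aa; apply/eqP.
    by apply: (@extra_unique a); rewrite // ?E ?E' inE // aa.
  have DE : D = [set b1; b2; b3].
    apply/esym/eqP; rewrite eqEcard; apply/andP; split.
      by apply/subsetP=> v; rewrite !inE -!orbA => /or3P[] /eqP->.
    rewrite cD d2; apply/card_geqP; exists [:: b1; b2; b3]; split=> //.
    by move=> v; rewrite !inE -!orbA.
  right; left; split=> //; exists (~: D), a1, a2, a3, x, b1, b2, b3.
  rewrite setCK; split.
    split=> //; apply/forall_inP=> v vD; apply/forall_inP=> v' v'D.
    by apply/negP=> vv'; have : v' \in N v; [rewrite mem_N vv'|rewrite N0 // inE].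
  have /andP[a1D a1x] := aS _ _ b1D E1; have /andP[a2D a2x] := aS _ _ b2D E2.
  have /andP[a3D a3x] := aS _ _ b3D E3.
  split; [| |exact: nbhE|exact: nbhE|exact: nbhE].
    have /and3P[n12 n13 n23] : [&& b1 != b2, b1 != b3 & b2 != b3].
      by move: ul; rewrite /= !inE negb_or andbT => /andP[/andP[-> ->] ->].
    rewrite /= !inE !negb_or a1x a2x a3x.
    by rewrite (naa b1 b2 a1 a2) // (naa b1 b3 a1 a3) // (naa b2 b3 a2 a3).
  by apply/subsetP=> v; rewrite !inE -!orbA => /or4P[] /eqP->.
case: nonham; apply: (@two_entries_hamiltonian G D S (d - #|S|) n2 clC SD adjSD
  extra_unique u w) => //.
- by rewrite ltn_subRL addn1.
- by rewrite cD subnK // ltnW.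
- by move=> v /degv; rewrite /N; clear; lia.
Qed.

Lemma low_degree_Sd_classified : classified.
Proof.
case: (boolP [exists (u | u \in D), extra D S u != set0]) => [/exists_inP[u uD eu]|/exists_inPn none].
  have [/exists_inP[w wD /andP[nwu ew]]|/exists_inPn none] :=
      boolP [exists (w | w \in D), (w != u) && (extra D S w != set0)].
    by apply: two_extra_classified eu ew; rewrite // eq_sym.
  apply: (one_extra_classified uD eu) => v vD nvu; apply/eqP.
  by have := none v vD; rewrite nvu /= negbK.
by apply: no_extra_classified => v /none; rewrite negbK => /eqP.
Qed.

End Classification.

Lemma min_degreeP (G : sgraph) (d : nat) :
  d <= min_degree G -> forall v : G, d <= #|nbh v|.
Proof.
move=> hd v; apply: leq_trans hd _; rewrite /min_degree.
have := mem_index_enum v; elim: (index_enum _) => // w s IH.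
rewrite inE big_cons => /predU1P[<-|/IH]; first exact: geq_minl.
exact: leq_trans (geq_minr _ _).
Qed.

Lemma saturated_classified (G : sgraph) n d k :
    saturated G -> nverts G = n -> 2 < n -> 0 < d -> d <= min_degree G ->
    1 < k -> hnat k n n.-1./2 < #|cliques G k| ->
    (d.+1 < n.-1./2 -> hnat k n d.+2 < #|cliques G k|) ->
  classified G n d.
Proof.
move=> satG Gn n2 d0 /min_degreeP deg k1; subst n => hf hd.
have [r [rd rf cr clr]] := saturated_structure satG n2 d0 deg k1 hf hd.
have rn : r < nverts G.
  by have := odd_double_half (nverts G).-1; move: rf; clear -n2; lia.
have lowP v : v \in low G r -> #|nbh v| <= r by rewrite inE.
case: rd => rd; subst r.
  exact: (low_degree_d_classified satG (erefl _) n2 d0 deg clr cr rn lowP).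
exact: (low_degree_Sd_classified satG (erefl _) n2 d0 deg clr cr rn lowP).
Qed.

Lemma cliques_mono (T : finType) (e e' : rel T) (sy : symmetric e)
    (ir : irreflexive e) (sy' : symmetric e') (ir' : irreflexive e') k :
  (forall x y, e x y -> e' x y) ->
  #|cliques (SGraph sy ir) k| <= #|cliques (SGraph sy' ir') k|.
Proof.
move=> sub; apply/subset_leq_card/subsetP=> S; rewrite !inE => /andP[-> /cliqueP cS].
by apply/cliqueP=> x y xS yS nxy; apply: sub; apply: cS.
Qed.

Theorem theorem7 (R : realFieldType) (n d : nat) (G : sgraph)
    (hn : 3 <= n) (hd : 1 <= d <= n.-1./2)
    (hG : #|G| = n) (hham : ~ hamiltonian G) (hdeg : d <= min_degree G)
    (hk : exists2 k : nat, 2 <= k &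
      (Num.max (h_ k n (d + 2)%:R) (h_ k n (n.-1./2)%:R)
         < #|cliques G k|%:R :> R)%R) :
  [/\ d = 2 -> exists H : sgraph,
        (is_G'2 n H \/ in_Hfamily n 2 H) /\ subgraph_of G H,
      d = 3 -> exists H : sgraph,
        (is_F3 n H \/ in_Hfamily n 3 H) /\ subgraph_of G H
    & d = 1 \/ 4 <= d <= n.-1./2 -> exists H : sgraph,
        in_Hfamily n d H /\ subgraph_of G H].
Proof.
case: hk => k k2; rewrite gt_max => /andP[hd2 hf].
case: G hG hham hdeg hd2 hf => T e sy ir Gn nh deg hd2 hf.
have [e' [sy' [ir' [sub satG]]]] := saturated_supergraph nh.
set G := SGraph sy ir in Gn nh deg hd2 hf *; set G' := SGraph sy' ir' in satG.
have le_N : #|cliques G k| <= #|cliques G' k| by apply: cliques_mono.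
have le_fn : n.-1./2 <= n by have := odd_double_half n.-1; clear; lia.
have deg' : d <= min_degree G'.
  apply: leq_trans deg _; rewrite /min_degree.
  elim/big_rec2: _ => // v a b _ le_ab; rewrite leq_min.
  rewrite (leq_trans (geq_minr _ _) le_ab) andbT.
  apply: leq_trans (geq_minl _ _) _; apply/subset_leq_card/subsetP=> w.
  by rewrite !inE; apply: sub.
have GG' H : subgraph_of G' H -> subgraph_of G H.
  by case=> f injf adjf; exists f => // x y xy; apply/adjf/sub.
have : classified G' n d.
  apply: (saturated_classified (k := k)) => //.
  - by case/andP: hd.
  - by move: hf; rewrite h_nat // ltr_nat => hf; apply: leq_trans hf le_N.
  - move=> lt_d; move: hd2; rewrite addn2 h_nat ?ltr_nat => [hd2|].
      by apply: leq_trans hd2 le_N.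
    by apply: leq_trans lt_d le_fn.
case=> [[H [hH /GG' sGH]]|[[d2 hG2]|[d3 hF]]].
- by split=> [d2|d3|_]; exists H; split=> //; try right; rewrite -?d2 -?d3.
- split=> [_|d3|]; last first.
  + by rewrite d2 => -[].
  + by move: d3; rewrite d2.
  + by exists G'; split; [left|apply/GG'/subgraph_of_refl].
- split=> [d2|_|]; last first.
  + by rewrite d3 => -[].
  + by exists G'; split; [left|apply/GG'/subgraph_of_refl].
  + by move: d3; rewrite d2.
Qed.
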